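(* For every $p\in[0,1]$, \[ \sqrt{\frac{2}{\pi}}\; p^*\log\frac{1}{p^*}\ \le\ \mathbb{E}_p\sqrt{\tau}\ \le\ \frac{4\sqrt{2}\,G}{\pi^{3/2}\ln 2}\; p^*\log\frac{1}{p^*}, \] where $p^*=\min\{p,1-p\}$, and both constants are sharp: the constant $\sqrt{2/\pi}$ cannot be replaced by a larger one and the constant $\frac{4\sqrt{2}\,G}{\pi^{3/2}\ln 2}$ cannot be replaced by a smaller one so that the corresponding inequality still holds for all $p\in[0,1]$.
   Context: $\tau=\inf\{t\ge 0: B_t\notin(0,1)\}$ is the first exit time from $(0,1)$ of a standard Brownian motion $(B_t)_{t\ge0}$ started at $B_0=p\in[0,1]$, and $\mathbb{E}_p$ is the corresponding expectation. $\log=\ln$ is the natural logarithm, $G=\sum_{k=0}^\infty\frac{(-1)^k}{(2k+1)^2}$ is Catalan's constant, and $0\cdot\log\frac10:=0$. *)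

(* Defs.v *)
From HB Require Import structures.
From mathcomp Require Import all_boot all_order all_algebra.
From mathcomp Require Import all_classical all_reals all_analysis.

Set Implicit Arguments.
Unset Strict Implicit.
Unset Printing Implicit Defensive.

Import Order.TTheory GRing.Theory Num.Theory.
Import numFieldNormedType.Exports.

Local Open Scope classical_set_scope.
Local Open Scope ring_scope.

(* The sets [A i] may be taken equal to [setT], so the product rule for the
   whole family contains the product rule for each subfamily. *)
Definition mutually_independent (d : measure_display) (T : measurableType d)
    (R : realType) (P : probability T R) (n : nat) (X : 'I_n -> T -> R) : Prop :=
  forall A : 'I_n -> set R, (forall i, measurable (A i)) ->
    P (\bigcap_(i in [set: 'I_n]) (X i @^-1` A i)) =
    (\prod_(i < n) P (X i @^-1` A i))%E.

(* Time is indexed by all of [R]; the random variables [B t] with [t < 0] are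
   arbitrary and play no role.  The second argument of [normal_prob] is the
   standard deviation. *)
Record brownian_motion (d : measure_display) (T : measurableType d)
    (R : realType) (P : probability T R) (x : R) (B : R -> {RV P >-> R}) : Prop :=
  BrownianMotion {
    bm_start : {ae P, forall w, B 0 w = x} ;
    bm_indep : forall (n : nat) (t : nat -> R),
      0 <= t 0%N -> (forall i : nat, (i < n)%N -> t i <= t i.+1) ->
      mutually_independent P (fun (i : 'I_n) w => B (t i.+1) w - B (t i) w) ;
    bm_normal : forall s t : R, 0 <= s -> s < t ->
      forall A : set R, measurable A ->
        P ((fun w => B t w - B s w) @^-1` A) =
        normal_prob 0 (Num.sqrt (t - s)) A ;
    bm_continuous : {ae P, forall w,
      {within `[0, +oo[, continuous (fun t : R => B t w)}}
  }.

(* Extended-real valued: it is [+oo] on a path which never leaves (0,1). *)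
Definition exit_time (T : Type) (R : realType) (B : R -> T -> R) (w : T) : \bar R :=
  ereal_inf [set t%:E | t in [set t : R | 0 <= t /\ B t w \notin `]0, 1[ ]].

(* [exit_time] is almost surely equal to a measurable function, and the
   integral of a nonnegative function (a supremum over the simple functions
   below it) does not change when the function is modified on a null set. *)
Definition expected_sqrt_exit_time (d : measure_display) (T : measurableType d)
    (R : realType) (P : probability T R) (B : R -> {RV P >-> R}) : \bar R :=
  (\int[P]_w sqrte (exit_time B w))%E.

Definition catalan (R : realType) : R :=
  limn (series (fun k : nat => (-1) ^+ k / (2 * k%:R + 1) ^+ 2 : R)).

(* [x * log (1 / x)]; since [0^-1 = 0], the value at [x = 0] is [0]. *)
Definition xlog_inv (R : realType) (x : R) : R := x * ln x^-1.

Definition lower_const (R : realType) : R := Num.sqrt (2 / pi).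

Definition upper_const (R : realType) : R :=
  4 * Num.sqrt 2 * catalan R / (pi `^ (3 / 2) * ln 2).

(* Main.v *)
(** Killing the Brownian motion when it leaves (a, b) and expanding in the
    eigenfunctions [sin (th_k (x - a))], [th_k = (2 k + 1) pi / (b - a)], gives
    [P (tau > t) = 4 / pi * sum_k exp (- th_k^2 t / 2) sin (th_k (p - a)) / (2 k + 1)].
    Each eigenfunction identity is optional stopping for the martingale
    [exp (th^2 t / 2) sin (th (B_t - a))], done on dyadic grids: because the sine
    vanishes at a and b, the overshoot is controlled by the modulus of continuity.
    Since [E (sqrt tau)] is the integral of [P (tau > u^2)] over [u >= 0], it equals
    [sqrt (2 / pi) * (2 / pi) * Phi (pi p)] with
    [Phi y = sum_k sin ((2 k + 1) y) / (2 k + 1)^2], whose derivative is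
    [- ln (tan (y / 2)) / 2]. What remains compares [Phi y] with
    [g y = y / 2 * ln (pi / y)] on (0, pi / 2]: [Phi - g] is increasing and at most
    [y / 2], while [C g - Phi] with [C = Phi (pi / 2) / g (pi / 2)] vanishes at both
    ends and has a derivative which is first positive, then negative. The constants
    are attained in the limit p -> 0 and at p = 1 / 2. *)
Require Import Defs.
From HB Require Import structures.
From mathcomp Require Import all_boot all_order all_algebra.
From mathcomp Require Import all_classical all_reals all_analysis.
From mathcomp Require Import measurable_realfun.
From mathcomp Require Import ring lra.

Set Implicit Arguments.
Unset Strict Implicit.
Unset Printing Implicit Defensive.

Import Order.TTheory GRing.Theory Num.Theory.
Import numFieldNormedType.Exports.

Local Open Scope classical_set_scope.
Local Open Scope ring_scope.

(** Odd frequencies suffice because the constant 1 on the interval is its own odd sine series: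
    [square_wave n] tends to [pi / 4] on (0, pi). Multiplying by the indicator of survival and
    integrating term by term turns the eigenfunction identities into the law of the exit time.
    Dominating this passage needs a bound on the partial sums uniform up to the endpoints, where
    they overshoot; it is supplied by [square_wave_bound]. The exit time is never shown to be
    measurable, nor is {tau > t} identified with survival at dyadic times: a path may touch the
    boundary between two dyadic times. Instead sqrt tau is squeezed between the survival time in (0,
    1) and the one in a slightly smaller interval, whose closure is avoided by the exit set. Since
    the expectation for (a, b) is an explicit multiple of b - a, shrinking costs only a factor 1 -
    e. On the analytic side the series for Phi is not differentiated: inequalities between
    derivatives are integrated for partial sums with an error of order 1 / n. The derivative blows
    up at 0, so integration starts from [pi / (m + 1) ^ 2] and m tends to infinity. The sign pattern
    of the derivative of C g - Phi rests on C >= pi / 2, that is pi ^ 2 ln 2 <= 8 G, a narrow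
    numerical inequality. *)

Section DerivativeRules.
Context {R : realType}.
Implicit Types (f g : R -> R) (x a b c : R).

Lemma is_derive1D f g x a b : is_derive x (1 : R) f a -> is_derive x (1 : R) g b ->
  is_derive x (1 : R) (fun y => f y + g y) (a + b).
Proof. by move=> df dg; apply: is_deriveD. Qed.

Lemma is_derive1N f x a : is_derive x (1 : R) f a ->
  is_derive x (1 : R) (fun y => - f y) (- a).
Proof. by move=> df; apply: is_deriveN. Qed.

Lemma is_derive1B f g x a b : is_derive x (1 : R) f a -> is_derive x (1 : R) g b ->
  is_derive x (1 : R) (fun y => f y - g y) (a - b).
Proof. by move=> df dg; apply: is_derive1D => //; exact: is_derive1N. Qed.

Lemma is_derive1M f g x a b : is_derive x (1 : R) f a -> is_derive x (1 : R) g b ->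
  is_derive x (1 : R) (fun y => f y * g y) (a * g x + f x * b).
Proof.
move=> df dg; apply: (is_derive_eq (is_deriveM df dg)).
by rewrite addrC mulrC.
Qed.

Lemma is_derive1Ml f x a c : is_derive x (1 : R) f a ->
  is_derive x (1 : R) (fun y => c * f y) (c * a).
Proof.
move=> df; apply: (is_derive_eq (is_derive1M (is_derive_cst c x 1) df)).
by rewrite mul0r add0r.
Qed.

Lemma is_derive1_compf f g x a b : is_derive (g x) (1 : R) f a ->
  is_derive x (1 : R) g b -> is_derive x (1 : R) (fun y => f (g y)) (a * b).
Proof. by move=> df dg; apply: is_derive1_comp. Qed.

Lemma is_derive1_sum n (f df : nat -> R -> R) x :
  (forall k, is_derive x (1 : R) (f k) (df k x)) ->
  is_derive x (1 : R) (fun y => \sum_(k < n) f k y) (\sum_(k < n) df k x).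
Proof.
move=> dfk; elim: n => [|n ih].
  under eq_fun do rewrite big_ord0.
  by rewrite big_ord0; exact: is_derive_cst.
under eq_fun do rewrite big_ord_recr/=.
by rewrite big_ord_recr/=; exact: is_derive1D.
Qed.

Lemma is_derive1_affine x c b : is_derive x (1 : R) (fun y => c * y + b) c.
Proof.
apply: (is_derive_eq (is_derive1D (is_derive1Ml c (is_derive_id x 1)) (is_derive_cst b x 1))).
by rewrite mulr1 addr0.
Qed.

Lemma is_derive1_continuous f x a : is_derive x (1 : R) f a -> {for x, continuous f}.
Proof.
move=> [df _]; apply: differentiable_continuous.
exact/derivable1_diffP.
Qed.

Lemma derive_ge0_le f (df : R -> R) a b : a <= b ->
  (forall x, a <= x <= b -> is_derive x (1 : R) f (df x)) ->
  (forall x, a <= x <= b -> 0 <= df x) -> f a <= f b.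
Proof.
move=> ab dfE df0.
have [||c cab e] := @MVT_segment _ f df a b ab.
- by move=> x /subset_itv_oo_cc; rewrite in_itv/=; exact: dfE.
- apply: derivable_within_continuous => x; rewrite in_itv/= => xab.
  by have [] := dfE x xab.
by rewrite -subr_ge0 e mulr_ge0 ?subr_ge0// df0//; move: cab; rewrite in_itv.
Qed.

End DerivativeRules.

(** * The characteristic function of the normal law *)

Section VanishingIntegral.
Context {R : realType}.
Notation mu := (@lebesgue_measure R).

Lemma finite_bounded_integrable d (T : measurableType d)
    (m : {finite_measure set T -> \bar R}) (f : T -> R) (M : R) :
  measurable_fun setT f -> (forall x, `|f x| <= M) ->
  m.-integrable setT (EFin \o f).
Proof.
move=> mf fM; apply: measurable_bounded_integrable => //.
  by rewrite -ge0_fin_numE// fin_num_measure.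
by exists M; split; [exact: num_real|move=> x Mx y _; apply: le_trans (ltW Mx)].
Qed.

(** The fundamental theorem of calculus on growing segments, with dominated convergence for the
    integral over the whole line. This is integration by parts with vanishing boundary terms. *)
Lemma integral_derivative_eq0 (f F : R -> R) :
  continuous f -> (forall x : R, is_derive x (1 : R) F (f x)) ->
  mu.-integrable setT (EFin \o f) ->
  F n%:R @[n --> \oo] --> 0 -> F (- n%:R) @[n --> \oo] --> 0 ->
  \int[mu]_x f x = 0.
Proof.
move=> cf dF fi Fy FNy.
pose A n : set R := `[- n.+1%:R, n.+1%:R]%classic.
have FE n : (\int[mu]_(x in A n) (f x)%:E = (F n.+1%:R - F (- n.+1%:R))%:E)%E.
  rewrite EFinB; apply: continuous_FTC2.
  - by rewrite gtrN// ltr0n.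
  - exact: continuous_subspaceT.
  - split => //.
    + apply: cvg_at_right_filter; apply: differentiable_continuous.
      by apply/derivable1_diffP; have [] := dF (- n.+1%:R).
    + apply: cvg_at_left_filter; apply: differentiable_continuous.
      by apply/derivable1_diffP; have [] := dF (n.+1%:R).
  - by move=> x _; rewrite derive1E; have [_ ->] := dF x.
have FE0 : (\int[mu]_(x in A n) (f x)%:E)%E @[n --> \oo] --> 0%E.
  under eq_fun do rewrite FE.
  apply: cvg_EFin; first exact: nearW.
  rewrite /comp /= -[X in _ --> X](subrr 0); apply: cvgB.
    by rewrite (cvg_shiftS (fun n => F n%:R)).
  by rewrite (cvg_shiftS (fun n => F (- n%:R))).
have FE1 : (\int[mu]_(x in A n) (f x)%:E)%E @[n --> \oo] --> (\int[mu]_x (f x)%:E)%E.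
  under eq_fun do rewrite integral_mkcond.
  apply: (@dominated_cvg _ _ _ mu _ _ _ _ (fun x => `|(f x)%:E|%E)) => //.
  - move=> n; apply/(measurable_restrictT (EFin \o f)) ; first exact: measurable_itv.
    exact: measurable_funTS (measurable_int mu fi).
  - move=> x _; apply: cvg_near_cst.
    near=> n.
    rewrite patchE mem_set// /A /= in_itv /=; rewrite -ler_norml.
    apply: (le_trans (ltW (archi_boundP (normr_ge0 x)))).
    rewrite ler_nat; apply: leqW; near: n; exact: nbhs_infty_ge.
  - exact: (integrable_abse fi).
  - move=> n x _; rewrite patchE; case: ifP => // _; rewrite abse0; exact: abse_ge0.
by rewrite /Rintegral (cvg_unique _ FE1 FE0).
Unshelve. all: end_near. Qed.

End VanishingIntegral.

Section NormalFourier.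
Context {R : realType}.
Notation mu := (@lebesgue_measure R).
Variable s : R.
Hypothesis s0 : 0 < s.
Let N := normal_pdf 0 s.
Let sn0 : s != 0. Proof. by rewrite gt_eqF. Qed.
Let s2n0 : 2 * s != 0. Proof. by rewrite mulf_neq0// pnatr_eq0. Qed.

Let is_derive_N (x : R) : is_derive x (1 : R) N (- (x / s ^+ 2) * N x).
Proof.
rewrite /N normal_pdfE// /normal_fun.
under eq_fun do rewrite subr0.
rewrite subr0.
apply: (is_derive_eq (is_derive1Ml _ (is_derive1_compf (is_derive_expR _)
  (is_derive1M (is_derive1N (is_derive1M (is_derive_id x 1) (is_derive_id x 1)))
    (is_derive_cst (s ^+ 2 *+ 2)^-1 x 1))))).
rewrite -expr2 /cst.
by field.
Qed.

Let N_ge0 x : 0 <= N x. Proof. exact: normal_pdf_ge0. Qed.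

(** A polynomial factor is absorbed by doubling the standard deviation, so integrability of a normal
    density is all that is used. With z = x / s, the quotient of the two Gaussians leaves [|z| <= 1
    + 3 z ^ 2 / 8 <= exp (3 z ^ 2 / 8)]. *)
Let norm_xN_le (x : R) : `|x| * N x <=
  s * (normal_peak s / normal_peak (2 * s)) * normal_pdf 0 (2 * s) x.
Proof.
have pk : normal_peak (2 * s) != 0 by rewrite gt_eqF// normal_peak_gt0.
rewrite /N !normal_pdfE// /normal_fun !subr0.
rewrite [leRHS](_ : _ = normal_peak s * (s * expR (- x ^+ 2 / ((2 * s) ^+ 2 *+ 2)))); last by field.
rewrite mulrCA ler_wpM2l ?normal_peak_ge0//.
have -> : - x ^+ 2 / (s ^+ 2 *+ 2) =
    - x ^+ 2 / ((2 * s) ^+ 2 *+ 2) - 3 * (x / s) ^+ 2 / 8 by field.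
rewrite expRD expRN mulrA ler_pdivrMr ?expR_gt0// mulrAC ler_wpM2r ?expR_ge0//.
rewrite -ler_pdivrMl//.
apply: le_trans (expR_ge1Dx _).
have -> : s^-1 * `|x| = `|x / s| by rewrite normrM normfV (gtr0_norm s0) mulrC.
rewrite -(real_normK (num_real (x / s))).
by have := sqr_ge0 (3 * `|x / s| - 4); set z := `|x / s|; nra.
Qed.

Let xN_integrable : mu.-integrable setT (fun x => (`|x| * N x)%:E).
Proof.
apply: (le_integrable measurableT _ _ (integrableZl measurableT
  (s * (normal_peak s / normal_peak (2 * s))) (integrable_normal_pdf 0 (2 * s)))).
- apply/measurable_EFinP; apply: measurable_funM.
    exact: normr_measurable.
  exact: measurable_normal_pdf.
- move=> x _; rewrite -EFinM lee_fin ger0_norm; first exact: le_trans (norm_xN_le x) (ler_norm _).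
  by rewrite mulr_ge0.
Qed.

Let mxN_integrable (h : R -> R) : measurable_fun setT h -> (forall x, `|h x| <= 1) ->
  mu.-integrable setT (EFin \o (fun x => h x * N x)).
Proof.
move=> mh h1; apply: (le_integrable measurableT _ _ (integrable_normal_pdf 0 s)) => //.
  apply/measurable_EFinP/measurable_funM => //; exact: measurable_normal_pdf.
move=> x _ /=; rewrite lee_fin normrM ler_piMl//.
Qed.

Let mxxN_integrable (h : R -> R) : measurable_fun setT h -> (forall x, `|h x| <= 1) ->
  mu.-integrable setT (EFin \o (fun x => x * h x * N x)).
Proof.
move=> mh h1; apply: (le_integrable measurableT _ _ xN_integrable) => //.
  apply/measurable_EFinP/measurable_funM; last exact: measurable_normal_pdf.
  exact: measurable_funM.
move=> x _ /=; rewrite lee_fin !normrM normr_id ler_wpM2r// ler_piMr//.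
Qed.

Let N_cvg0 (x_ : nat -> R) : (forall n, n%:R <= `|x_ n|) -> N (x_ n) @[n --> \oo] --> 0.
Proof.
move=> nx; pose K := s * (normal_peak s / normal_peak (2 * s)) * normal_peak (2 * s).
have K0 : 0 <= K by rewrite !mulr_ge0 ?invr_ge0 ?normal_peak_ge0// ltW.
rewrite -(cvg_shiftS (fun n => N (x_ n))).
apply: (@squeeze_cvgr _ _ _ _ (cst 0) (fun n => K * n.+1%:R^-1)).
- near=> n; rewrite N_ge0/= ler_pdivlMr ?ltr0n// mulrC.
  apply: le_trans (_ : `|x_ n.+1| * N (x_ n.+1) <= _); first by rewrite ler_wpM2r.
  apply: (le_trans (norm_xN_le _)); rewrite ler_wpM2l//.
    by rewrite !mulr_ge0 ?invr_ge0 ?normal_peak_ge0// ltW.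
  exact: normal_pdf_ub.
- exact: cvg_cst.
- rewrite -[X in _ --> X](mulr0 K); apply: cvgMr; exact: cvg_harmonic.
Unshelve. all: end_near. Qed.

Let continuous_N : continuous N.
Proof. exact: continuous_normal_pdf. Qed.

Let continuous_phase (f : R -> R) (th ph : R) : continuous f ->
  continuous (fun x : R => f (th * x + ph)).
Proof.
move=> cf x; apply: (@continuous_comp _ _ _ (fun x : R => th * x + ph) f); last exact: cf.
exact: is_derive1_continuous (is_derive1_affine x th ph).
Qed.

Let Phi (ph th : R) := \int[mu]_x (sin (th * x + ph) * N x).

Let msin (th ph : R) : measurable_fun setT (fun x : R => sin (th * x + ph)).
Proof. by apply: continuous_measurable_fun; apply: continuous_phase; exact: continuous_sin. Qed.

Let mcos (th ph : R) : measurable_fun setT (fun x : R => cos (th * x + ph)).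
Proof. by apply: continuous_measurable_fun; apply: continuous_phase; exact: continuous_cos. Qed.

Let is_derive_Phi (ph th : R) :
  is_derive th (1 : R) (Phi ph) (\int[mu]_x (x * cos (th * x + ph) * N x)).
Proof.
pose f (t x : R) := sin (t * x + ph) * N x.
have df (t x : R) : is_derive t (1 : R) (f ^~ x) (x * cos (t * x + ph) * N x).
  apply: (is_derive_eq (is_derive1M (is_derive1_compf (is_derive_sin _)
    (_ : is_derive t (1 : R) (fun t => t * x + ph) x)) (is_derive_cst (N x) t 1))).
    apply: (is_derive_eq (is_derive1D (is_derive1M (is_derive_id t 1) (is_derive_cst x t 1)) (is_derive_cst ph t 1))).
    by rewrite /cst; ring.
  by rewrite /cst; ring.
have fE (t x : R) : partial1of2 f t x = x * cos (t * x + ph) * N x.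
  by rewrite partial1of2E; have [_ ->] := df t x.
have A : forall x : R, (`](th - 1), (th + 1)[%classic : set R) x -> mu.-integrable setT (EFin \o f x).
  by move=> x _; apply: mxN_integrable => // y; exact: sin_max.
have B : (`](th - 1), (th + 1)[%classic : set R) th.
  by rewrite /= in_itv/= ltrDl gtrBl ltr01.
have D : forall x y : R, (`](th - 1), (th + 1)[%classic : set R) x -> setT y -> derivable (f ^~ y) x 1.
  by move=> x y _ _; have [] := df x y.
have E : forall x y : R, (`](th - 1), (th + 1)[%classic : set R) x -> setT y -> `|partial1of2 f x y| <= `|y| * N y.
  move=> x y _ _; rewrite fE !normrM -mulrA ler_wpM2l// (ger0_norm (N_ge0 y)).
  by rewrite ler_piMl// cos_max.
have H0 y : 0 <= `|y| * N y by rewrite mulr_ge0.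
apply: DeriveDef.
  exact: (derivable_under_integral measurableT B A D H0 xN_integrable E).
rewrite -derive1E (differentiation_under_integral measurableT B A D H0 xN_integrable E).
by apply: eq_Rintegral => x _; exact: fE.
Qed.

(** Integration by parts, as [N' = - (x / s ^ 2) N]: the primitive is [cos (th * x + ph) * N x].
    Together with differentiation under the integral it gives the linear equation Phi' = - s ^ 2 th
    Phi in th. *)
Let Phi_ibp (ph th : R) :
  \int[mu]_x (x * cos (th * x + ph) * N x) = - s ^+ 2 * th * Phi ph th.
Proof.
have ic : mu.-integrable setT (EFin \o (fun x : R => x * cos (th * x + ph) * N x)).
  by apply: mxxN_integrable => // y; exact: cos_max.
have is_ : mu.-integrable setT (EFin \o (fun x : R => sin (th * x + ph) * N x)).
  by apply: mxN_integrable => // y; exact: sin_max.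
pose f x := - s ^- 2 * (x * cos (th * x + ph) * N x) + - th * (sin (th * x + ph) * N x).
have : \int[mu]_x f x = 0.
  apply: (@integral_derivative_eq0 _ f (fun x => cos (th * x + ph) * N x)).
  - move=> x; apply: cvgD; apply: cvgMr.
      by apply: cvgM; [apply: cvgM; [exact: cvg_id|exact: continuous_phase (@continuous_cos R) _]|exact: continuous_N].
    by apply: cvgM; [exact: continuous_phase (@continuous_sin R) _|exact: continuous_N].
  - move=> x; apply: (is_derive_eq (is_derive1M (is_derive1_compf (is_derive_cos _)
      (is_derive1_affine x th ph)) (is_derive_N x))).
    by rewrite /f; field.
  - rewrite /f /comp; under eq_fun do rewrite EFinD !EFinM.
    by apply: integrableD => //; exact: integrableZl.
  - apply: norm_cvg0; apply: (@squeeze_cvgr _ _ _ _ (cst 0) (fun n => N n%:R)); last 2 first.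
    + exact: cvg_cst.
    + by apply: N_cvg0 => n; rewrite ger0_norm.
    by near=> n; rewrite normr_ge0 /= normrM (ger0_norm (N_ge0 _)) ler_piMl// cos_max.
  - apply: norm_cvg0; apply: (@squeeze_cvgr _ _ _ _ (cst 0) (fun n => N (- n%:R))); last 2 first.
    + exact: cvg_cst.
    + by apply: N_cvg0 => n; rewrite normrN ger0_norm.
    by near=> n; rewrite normr_ge0 /= normrM (ger0_norm (N_ge0 _)) ler_piMl// cos_max.
rewrite /f RintegralD//; last 2 first.
- by rewrite /comp; under eq_fun do rewrite EFinM; exact: integrableZl.
- by rewrite /comp; under eq_fun do rewrite EFinM; exact: integrableZl.
rewrite !RintegralZl// -/(Phi ph th) => e.
apply: (mulfI (_ : - s ^- 2 != 0)); first by rewrite oppr_eq0 invr_neq0// expf_neq0.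
rewrite (_ : - s ^- 2 * (- s ^+ 2 * th * Phi ph th) = th * Phi ph th); last by field.
by move/eqP: e; rewrite addr_eq0 => /eqP ->; rewrite mulNr opprK.
Unshelve. all: end_near. Qed.

(** Multiplying Phi by [expR (th ^+ 2 * s ^+ 2 / 2)] cancels the decay in its differential equation,
    so the product is constant and equals its value [sin ph] at th = 0. The free phase makes one
    real identity play the role of the complex characteristic function. *)
Lemma integral_sin_normal_pdf (th ph : R) :
  \int[mu]_x (sin (th * x + ph) * normal_pdf 0 s x) =
  expR (- (th ^+ 2 * s ^+ 2 / 2)) * sin ph.
Proof.
pose H t := Phi ph t * expR (t ^+ 2 * s ^+ 2 / 2).
have dH (t : R) : is_derive t (1 : R) H 0.
  have dE : is_derive t (1 : R) (fun t => expR (t ^+ 2 * s ^+ 2 / 2)) (expR (t ^+ 2 * s ^+ 2 / 2) * (t * s ^+ 2)).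
    apply: (is_derive_eq (is_derive1_compf (is_derive_expR _) (is_derive1M (is_derive1M
      (is_derive1M (is_derive_id t 1) (is_derive_id t 1)) (is_derive_cst (s ^+ 2) t 1)) (is_derive_cst (2^-1 : R) t 1)))).
    by rewrite /cst; field.
  apply: (is_derive_eq (is_derive1M (is_derive_Phi ph t) dE)).
  by rewrite Phi_ibp; ring.
have := is_derive_0_is_cst th 0 dH.
rewrite /H expr0n/= !mul0r expR0 mulr1 => e.
rewrite -/(Phi ph th) expRN -[LHS](mulfK (_ : expR (th ^+ 2 * s ^+ 2 / 2) != 0)) ?gt_eqF ?expR_gt0//.
rewrite e mulrC; congr (_ * _).
rewrite /Phi; under eq_Rintegral do rewrite mul0r add0r.
rewrite RintegralZl//; last exact: integrable_normal_pdf.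
by rewrite /Rintegral integral_normal_pdf mulr1.
Qed.

(** Change of variables with the Radon-Nikodym derivative, which agrees almost everywhere with the
    density because both have the same integral over every measurable set. *)
Lemma integral_normal_prob (f : R -> R) (M : R) :
  measurable_fun setT f -> (forall x, `|f x| <= M) ->
  \int[normal_prob 0 s]_x f x = \int[mu]_x (f x * normal_pdf 0 s x).
Proof.
move=> mf fM.
have fi : (normal_prob 0 s).-integrable setT (EFin \o f).
  exact: (@finite_bounded_integrable _ _ _ (normal_prob 0 s) f M mf fM).
rewrite /Rintegral; congr fine.
rewrite -(Radon_Nikodym_change_of_variables (normal_prob_dominates 0 s) measurableT fi)//.
under [RHS]eq_integral do rewrite EFinM.
apply: ae_eq_integral => //.
- apply: emeasurable_funM => //; first exact/measurable_EFinP.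
  apply: (measurable_int mu).
  by apply: Radon_Nikodym_integrable; exact: normal_prob_dominates.
- apply: emeasurable_funM => //; first exact/measurable_EFinP.
  by apply/measurable_EFinP; exact: measurable_normal_pdf.
- apply: ae_eqe_mul2l => /=.
  rewrite Radon_NikodymE//=; first exact: normal_prob_dominates.
  move=> abmu; case: cid => /= h [h1 h2 h3].
  apply: integral_ae_eq => //=.
  + by apply/measurable_EFinP; exact: measurable_normal_pdf.
  + by move=> E E01 mE; rewrite -h3.
Qed.

Lemma integral_sin_normal_prob (th ph : R) :
  \int[normal_prob 0 s]_x sin (th * x + ph) =
  expR (- (th ^+ 2 * s ^+ 2 / 2)) * sin ph.
Proof.
rewrite (@integral_normal_prob _ 1) ?integral_sin_normal_pdf// => x.
exact: sin_max.
Qed.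

Lemma normal_prob_set1 (c : R) : normal_prob 0 s [set c] = 0%E.
Proof.
have := normal_prob_dominates 0 s; move/null_content_dominatesP; apply => //.
exact: lebesgue_measure_set1.
Qed.

End NormalFourier.

(** * Brownian motion killed at the exit from an interval *)

Section Independence.
Context d (T : measurableType d) (R : realType) (P : probability T R).

Definition mfun_of d' (T' : measurableType d') (f : T -> T')
    (mf : measurable_fun setT f) : {mfun T >-> T'} :=
  MeasurableFun.Pack (MeasurableFun.Class (isMeasurableFun.Build _ _ _ _ f mf)).

(** Dynkin's argument: the events satisfying the product rule with a fixed [B] form a Dynkin
    system. *)
Lemma independent_g_sigma_algebra (G : set (set T)) (B : set T) :
  setI_closed G -> G `<=` measurable -> measurable B ->
  (forall E, G E -> P (E `&` B) = (P E * P B)%E) ->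
  forall E, <<s G >> E -> P (E `&` B) = (P E * P B)%E.
Proof.
move=> GI mG mB indG.
suff : <<s G >> `<=` [set E | measurable E /\ P (E `&` B) = (P E * P B)%E].
  by move=> GH E /GH[].
rewrite -setI_closed_g_dynkin_g_sigma_algebra//.
apply: smallest_sub; last by move=> E GE; split; [exact: mG|exact: indG].
split.
- by split => //; rewrite setTI probability_setT mul1e.
- move=> E [mE PE]; split; first exact: measurableC.
  have fE : P E \is a fin_num by exact: fin_num_measure.
  have fB : P B \is a fin_num by exact: fin_num_measure.
  rewrite probability_setC// muleBl ?fin_num_adde_defr// mul1e -PE setIC -setDE.
  by rewrite measureD// ?(le_lt_trans (probability_le1 _ _)) ?ltry// setIC.
- move=> F tF HF; split; first by apply: bigcup_measurable => k _; have [] := HF k.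
  rewrite setI_bigcupl measure_bigcup//; last 2 first.
  + by move=> k _; apply: measurableI => //; have [] := HF k.
  + exact: trivIset_setIr.
  rewrite measure_bigcup//; last by move=> k _; have [] := HF k.
  have fB : P B \is a fin_num by exact: fin_num_measure.
  rewrite muleC -(fineK fB) -nneseriesZl//.
  by apply: eq_eseriesr => k _; rewrite fineK// muleC; have [] := HF k.
Qed.

(** Independence makes the joint law of [Y] and [Z] the product of the marginals, by uniqueness of
    product measures; Fubini then integrates [Z] out first. *)
Lemma integral_independent d1 d2 (T1 : measurableType d1) (T2 : measurableType d2)
    (Y : {RV P >-> T1}) (Z : {RV P >-> T2}) (f : T1 * T2 -> R) (M : R) :
  (forall C D, measurable C -> measurable D ->
    P (Y @^-1` C `&` Z @^-1` D) = (P (Y @^-1` C) * P (Z @^-1` D))%E) ->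
  measurable_fun setT f -> (forall x, `|f x| <= M) ->
  \int[P]_w f (Y w, Z w) = \int[P]_w \int[distribution P Z]_z f (Y w, z).
Proof.
move=> indYZ mf fM.
pose YZ : {RV P >-> (T1 * T2)%type} :=
  mfun_of (measurable_fun_pair (measurable_funPT Y) (measurable_funPT Z)).
pose mY : probability _ R := distribution P Y.
pose mZ : probability _ R := distribution P Z.
have YZE : forall A, measurable A -> A `<=` setT -> (distribution P YZ) A = (mY \x mZ)%E A.
  move=> A mA _; apply/esym; apply: (@product_measure_unique _ _ _ _ _ mY mZ (distribution P YZ)) => //.
have fi : (mY \x mZ)%E.-integrable setT (EFin \o f).
  apply: measurable_bounded_integrable => //.
  - have := YZE _ measurableT (@subsetT _ _); rewrite probability_setT => e.
    by apply: (@le_lt_trans _ _ 1%E); rewrite ?ltry// e.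
  - by exists M; split; [exact: num_real|move=> x Mx y _; apply: le_trans (ltW Mx)].
have fPi : P.-integrable setT ((EFin \o f) \o YZ).
  apply: (@finite_bounded_integrable R _ _ P (f \o YZ) M).
    exact: measurableT_comp.
  by move=> w; exact: fM.
have fZi y : mZ.-integrable setT (EFin \o (fun z => f (y, z))).
  apply: (@finite_bounded_integrable R _ _ mZ (fun z => f (y, z)) M) => //.
  exact: measurableT_comp.
have inner y : (\int[mZ]_z (f (y, z))%:E)%E = (\int[mZ]_z f (y, z))%:E.
  by rewrite /Rintegral fineK//; apply: integrable_fin_num => //; exact: fZi.
have Fi := integrable_fubini_F fi.
rewrite /Rintegral; congr fine.
transitivity (\int[distribution P YZ]_x (f x)%:E)%E.
  by rewrite integral_distribution//; exact/measurable_EFinP.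
rewrite (eq_measure_integral _ YZE) -integral12_prod_meas1//.
rewrite integral_distribution//.
- by apply: eq_integral => w _; rewrite /fubini_F/= inner.
- exact: measurable_int Fi.
- have -> : fubini_F mZ (EFin \o f) \o Y = EFin \o (fun w => \int[mZ]_z f (Y w, z)).
    by apply/funext => w; rewrite /fubini_F/= inner.
  apply: (@finite_bounded_integrable R _ _ P _ M) => //.
    apply: (eq_measurable_fun (fine \o (fubini_F mZ (EFin \o f) \o Y))).
      by move=> w _; rewrite /fubini_F/= inner.
    apply: measurableT_comp => //; apply: measurableT_comp => //.
    exact: measurable_int Fi.
  move=> w; apply: (le_trans (le_normr_Rintegral _ (fZi (Y w)))) => //.
  rewrite -[leRHS]mulr1 -[X in _ * X](_ : fine (mZ setT) = 1); last by rewrite probability_setT.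
  rewrite -Rintegral_cst//; apply: le_Rintegral => //.
    exact: integrable_norm.
  apply: (@finite_bounded_integrable R _ _ mZ (cst M) `|M|) => //.
Qed.
End Independence.

Lemma norm_sinB_le (R : realType) (u v : R) : `|sin u - sin v| <= `|u - v|.
Proof.
wlog uv : u v / u <= v.
  move=> h; have [/h//|/ltW/h] := leP u v.
  by rewrite distrC [leRHS]distrC.
rewrite distrC [leRHS]distrC (ger0_norm (_ : 0 <= v - u)) ?subr_ge0// ler_norml; apply/andP; split.
  rewrite -subr_ge0 (_ : _ - _ = (v + sin v) - (u + sin u)); last by ring.
  by rewrite subr_ge0; apply: (@derive_ge0_le _ (fun y => y + sin y) (fun y => 1 + cos y)).
rewrite -subr_ge0 (_ : _ - _ = (v - sin v) - (u - sin u)); last by ring.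
by rewrite subr_ge0; apply: (@derive_ge0_le _ (fun y => y - sin y) (fun y => 1 - cos y)).
Qed.

Lemma integrable_EFinD d (T : measurableType d) (R : realType)
    (m : {measure set T -> \bar R}) (f g : T -> R) :
  m.-integrable setT (EFin \o f) -> m.-integrable setT (EFin \o g) ->
  m.-integrable setT (EFin \o (fun w => f w + g w)).
Proof. by move=> fi gi; exact: (integrableD measurableT fi gi). Qed.

Lemma integrable_EFinZl d (T : measurableType d) (R : realType)
    (m : {measure set T -> \bar R}) (c : R) (f : T -> R) :
  m.-integrable setT (EFin \o f) ->
  m.-integrable setT (EFin \o (fun w => c * f w)).
Proof. by move=> fi; exact: (integrableZl measurableT c fi). Qed.

Lemma measurable_sin (R : realType) : measurable_fun setT (@sin R).
Proof. exact: continuous_measurable_fun (@continuous_sin R). Qed.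

Lemma measurable_sin_affine (R : realType) (th ph : R) :
  measurable_fun setT (fun z : R => sin (th * z + ph)).
Proof.
apply: continuous_measurable_fun => y.
apply: (@continuous_comp _ _ _ (fun x : R => th * x + ph) sin); last exact: continuous_sin.
exact: is_derive1_continuous (is_derive1_affine y th ph).
Qed.

Lemma Rintegral_cst_probability d (T : measurableType d) (R : realType)
    (P : probability T R) (c : R) : \int[P]_w c = c.
Proof.
rewrite /Rintegral integral_cst//= -[RHS]/(fine c%:E); congr fine.
by rewrite -[RHS]mule1; congr (_ * _)%E; exact: probability_setT.
Qed.

(** * Optional stopping for the walk killed outside an interval, along a time grid *)

Section KilledChain.
Context d (T : measurableType d) (R : realType) (P : probability T R).
Variables (x : R) (B : R -> {RV P >-> R}).
Hypothesis hB : brownian_motion x B.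
Variable tt : nat -> R.
Hypotheses (tt0 : tt 0%N = 0) (tt_nd : forall i, tt i <= tt i.+1).
Variables (a b : R).

Lemma tt_ge0 i : 0 <= tt i.
Proof. by elim: i => [|m ih]; rewrite ?tt0// (le_trans ih). Qed.

Definition increment (i : nat) (w : T) : R := B (tt i.+1) w - B (tt i) w.

(* One step of a walk killed when it leaves ]a, b[; the cemetery is the point a. *)
Definition kill_step (y z : R) : R :=
  if (y != a) && (a < y + z < b) then y + z else a.

Fixpoint killed (n : nat) (w : T) : R :=
  if n is m.+1 then kill_step (killed m w) (increment m w) else x.

(** The assumption on Brownian motion gives the product rule only for such rectangles. They are
    stable under intersection and generate the past of the first [n] increments. *)
Let rect (n : nat) : set (set T) := [set E | exists2 A : nat -> set R,
  (forall i, measurable (A i)) & E = \bigcap_(i < n) (increment i @^-1` A i)].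

Lemma measurable_increment i : measurable_fun setT (increment i).
Proof. exact: measurable_funB. Qed.

Let rectI n : setI_closed (rect n).
Proof.
move=> _ _ [A mA ->] [C mC ->]; exists (fun i => A i `&` C i).
  by move=> i; exact: measurableI.
by rewrite -bigcapI; apply: eq_bigcapr => i _; rewrite preimage_setI.
Qed.

Let measurable_preimage_increment i A : measurable A -> measurable (increment i @^-1` A).
Proof. by move=> mA; rewrite -[X in measurable X]setTI; exact: measurable_increment. Qed.

Let rect_measurable n : rect n `<=` measurable.
Proof.
move=> _ [A mA ->]; apply: bigcap_measurableType => i _.
exact: measurable_preimage_increment.
Qed.

Let rectP n (A : nat -> set R) : (forall i, measurable (A i)) ->
  P (\bigcap_(i < n) (increment i @^-1` A i)) = (\prod_(i < n) P (increment i @^-1` A i))%E.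
Proof.
move=> mA.
have := bm_indep hB (n := n) (t := tt); rewrite tt0 => /(_ (lexx _) (fun i _ => tt_nd i)).
move=> /(_ (fun i => A i) (fun i => mA i)) <-; congr (P _).
apply/seteqP; split => w h.
  by move=> i _; apply: h => /=.
by move=> i /= ij; exact: (h (Ordinal ij) I).
Qed.

Let rect_indep n C E : measurable C -> rect n E ->
  P (E `&` increment n @^-1` C) = (P E * P (increment n @^-1` C))%E.
Proof.
move=> mC [A mA ->].
pose A' i := if i == n then C else A i.
have mA' i : measurable (A' i) by rewrite /A'; case: ifP.
have AA' i : (i < n)%N -> A' i = A i by rewrite /A' => /ltn_eqF ->.
rewrite (rectP _ mA) [X in P X](_ : _ = \bigcap_(i < n.+1) (increment i @^-1` A' i)).
  rewrite (rectP _ mA') big_ord_recr/= {2}/A' eqxx; congr (_ * _)%E.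
  by apply: eq_bigr => i _; rewrite AA'.
apply/seteqP; split => w /=.
  move=> [hA hC] i /=; rewrite ltnS leq_eqVlt => /predU1P[->|ij].
    by rewrite /A' eqxx.
  by rewrite AA'//; exact: hA.
move=> h; split.
  by move=> i /= ij; rewrite -AA'//; apply: h => /=; rewrite ltnS ltnW.
by have := h n (ltnSn n); rewrite /A' eqxx.
Qed.

Lemma measurable_kill_step : measurable_fun setT (fun u : R * R => kill_step u.1 u.2).
Proof.
apply: measurable_fun_ifT => //; last exact: measurable_funD.
apply: measurable_and; last first.
  by apply: measurable_and; apply: measurable_fun_ltr => //; exact: measurable_funD.
apply: (measurable_neg (f := fun u : R * R => u.1 == a)).
exact: measurable_fun_eqr.
Qed.

Let killed_sigma n m : (m <= n)%N ->
  measurable_fun (setT : set (g_sigma_algebraType (rect n))) (killed m).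
Proof.
elim: m => [|m ih] mn; first exact: measurable_cst.
suff h : measurable_fun (setT : set (g_sigma_algebraType (rect n)))
    (fun w => (killed m w, increment m w)).
  exact: (measurableT_comp measurable_kill_step h).
apply/measurable_fun_pair; first exact: ih (ltnW mn).
move=> _ A mA; rewrite setTI; apply: sub_sigma_algebra.
exists (fun i => if i == m then A else setT); first by move=> i; case: ifP.
apply/seteqP; split => w /=.
  by move=> h i _ /=; case: eqP => // ->.
by move=> /(_ m mn); rewrite /= eqxx.
Qed.

Lemma measurable_killed n : measurable_fun setT (killed n).
Proof.
elim: n => [|n ih]; first exact: measurable_cst.
suff h : measurable_fun setT (fun w => (killed n w, increment n w)).
  exact: (measurableT_comp measurable_kill_step h).
by apply/measurable_fun_pair => //; exact: measurable_increment.
Qed.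

(** The killed position at step [n] is a function of the increments before [n], hence measurable for
    the sigma-algebra generated by [rect n]; independence extends from rectangles to it. *)
Lemma killed_indep n C D : measurable C -> measurable D ->
  P (killed n @^-1` C `&` increment n @^-1` D) =
  (P (killed n @^-1` C) * P (increment n @^-1` D))%E.
Proof.
move=> mC mD; apply: (@independent_g_sigma_algebra _ _ _ _ (rect n)) => //.
- exact: measurable_preimage_increment.
- by move=> E; exact: rect_indep.
- have := killed_sigma (leqnn n) measurableT mC; rewrite setTI; exact.
Qed.

Variable th : R.
Let decay (t : R) := expR (- (th ^+ 2 * t / 2)).

Let measurable_increment' n :
  measurable_fun setT (increment n : T -> measurableTypeR R).
Proof. exact: measurable_increment. Qed.

Lemma integral_sin_increment n ph :
  \int[distribution P (mfun_of (measurable_increment' n) : {RV P >-> measurableTypeR R})]_z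
    sin (th * z + ph) = decay (tt n.+1 - tt n) * sin ph.
Proof.
set Z := (mfun_of _ : {RV P >-> measurableTypeR R}).
(* [bm_normal] requires distinct times. At a repeated time the increment is zero and the decay
   factor is 1; capped grids do produce such repetitions. *)
have := tt_nd n; rewrite le_eqVlt => /predU1P[e|lt_tt].
  rewrite /decay e subrr mulr0 mul0r oppr0 expR0 mul1r.
  transitivity (\int[P]_w (sin (th * Z w + ph))).
    rewrite /Rintegral integral_distribution//.
      by apply/measurable_EFinP; exact: measurable_sin_affine.
    apply: (@finite_bounded_integrable R _ _ P (fun w => sin (th * Z w + ph)) 1).
      apply: (measurableT_comp (measurable_sin_affine th ph)).
      exact: measurable_increment.
    by move=> w; exact: sin_max.
  under eq_Rintegral do rewrite /Z/= /increment e subrr mulr0 add0r.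
  exact: Rintegral_cst_probability.
have dE : forall A, measurable A -> A `<=` setT ->
    distribution P Z A = normal_prob 0 (Num.sqrt (tt n.+1 - tt n)) A.
  move=> A mA _; apply: (bm_normal hB) => //.
  exact: tt_ge0.
rewrite /Rintegral (@eq_measure_integral _ _ R setT
  (normal_prob 0 (Num.sqrt (tt n.+1 - tt n))) (distribution P Z) _ dE).
have := integral_sin_normal_prob (s := Num.sqrt (tt n.+1 - tt n)) _ th ph.
rewrite /Rintegral => -> //.
  by rewrite sqr_sqrtr// subr_ge0.
by rewrite sqrtr_gt0 subr_gt0.
Qed.

(** The value of the eigenfunction at the point just outside ]a, b[ to which the walk would have
    jumped: what killing removes at step [n]. *)
Definition escape (n : nat) (w : T) : R :=
  if (killed n w != a) && ~~ (a < killed n w + increment n w < b)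
  then sin (th * (killed n w + increment n w - a)) else 0.

Let measurable_sin_killed n : measurable_fun setT (fun w => sin (th * (killed n w - a))).
Proof.
apply: (measurableT_comp (@measurable_sin R)).
apply: measurable_funM => //; apply: measurable_funB => //; exact: measurable_killed.
Qed.

Let measurable_escape n : measurable_fun setT (escape n).
Proof.
have mk := measurable_killed n; have mi := measurable_increment n.
have mki : measurable_fun setT (fun w => killed n w + increment n w).
  exact: measurable_funD.
apply: measurable_fun_ifT => //; last first.
  apply: (measurableT_comp (@measurable_sin R)).
  by apply: measurable_funM => //; exact: measurable_funB.
apply: measurable_and.
  by apply: (measurable_neg (f := fun w => killed n w == a)); exact: measurable_fun_eqr.
by apply: measurable_neg; apply: measurable_and; exact: measurable_fun_ltr.
Qed.

(** Surviving and escaping parts add up to the sine of the unkilled next position, and averaging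
    over the independent increment multiplies the present sine by the decay factor. A dead walk
    contributes nothing, as the sine vanishes at the cemetery [a]. *)
Lemma integral_escape n :
  \int[P]_w sin (th * (killed n.+1 w - a)) + \int[P]_w escape n w =
  decay (tt n.+1 - tt n) * \int[P]_w sin (th * (killed n w - a)).
Proof.
pose Y := (mfun_of (measurable_killed n) : {RV P >-> R}).
pose Z := (mfun_of (measurable_increment' n) : {RV P >-> measurableTypeR R}).
pose f (u : R * measurableTypeR R) := if u.1 != a then sin (th * u.2 + th * (u.1 - a)) else 0.
have f1 u : `|f u| <= 1 by rewrite /f; case: ifP; rewrite ?sin_max// normr0.
have mf : measurable_fun setT f.
  apply: measurable_fun_ifT => //.
    by apply: (measurable_neg (f := fun u : R * R => u.1 == a)); exact: measurable_fun_eqr.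
  apply: (measurableT_comp (@measurable_sin R)); apply: measurable_funD.
    exact: measurable_funM.
  by apply: measurable_funM => //; exact: measurable_funB.
have := integral_independent (@killed_indep n : forall C D, _ -> _ ->
  P (Y @^-1` C `&` Z @^-1` D) = (P (Y @^-1` C) * P (Z @^-1` D))%E) mf f1.
under [X in _ = X -> _]eq_Rintegral => w _.
  rewrite (_ : \int[_]_z _ = decay (tt n.+1 - tt n) * sin (th * (killed n w - a))); last first.
    rewrite /f/=; have [e|ne] := eqVneq (killed n w) a.
      by rewrite e subrr mulr0 sin0 mulr0 Rintegral_cst_probability.
    exact: integral_sin_increment.
  over.
rewrite RintegralZl//; last first.
  by apply: (@finite_bounded_integrable R _ _ P _ 1) => // w; exact: sin_max.
move=> <-; rewrite -RintegralD//.
- apply: eq_Rintegral => w _; rewrite /f /escape/= /kill_step.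
  have [e|ne] := eqVneq (killed n w) a; first by rewrite subrr mulr0 sin0 addr0.
  have [inab|outab] := boolP (a < killed n w + increment n w < b); rewrite /=.
    by rewrite addr0; congr sin; ring.
  by rewrite subrr mulr0 sin0 add0r; congr sin; ring.
- by apply: (@finite_bounded_integrable R _ _ P _ 1) => // w; exact: sin_max.
- apply: (@finite_bounded_integrable R _ _ P _ 1) => // w.
  by rewrite /escape; case: ifP; rewrite ?sin_max// normr0.
Qed.

Let growth (t : R) := expR (th ^+ 2 * t / 2).

(* Optional stopping for the martingale [growth t * sin (th * (B t - a))]. *)
Definition stopped (n : nat) (w : T) : R :=
  growth (tt n) * sin (th * (killed n w - a)) + \sum_(j < n) growth (tt j.+1) * escape j w.

Lemma measurable_stopped n : measurable_fun setT (stopped n).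
Proof.
apply: measurable_funD; first by apply: measurable_funM => //; exact: measurable_sin_killed.
by apply: measurable_sum => j; apply: measurable_funM => //; exact: measurable_escape.
Qed.

(** The change of [stopped] over one step has mean zero, because [growth] cancels the decay factor
    of [integral_escape]. *)
Lemma integral_stopped n : \int[P]_w stopped n w = sin (th * (x - a)).
Proof.
elim: n => [|n ih].
  rewrite /stopped.
  under eq_Rintegral do rewrite big_ord0 addr0 /growth tt0 mulr0 mul0r expR0 mul1r.
  exact: (Rintegral_cst_probability P (sin (th * (x - a)))).
pose u m w := sin (th * (killed m w - a)).
have iu m : P.-integrable setT (EFin \o u m).
  apply: (@finite_bounded_integrable R _ _ P _ 1); first exact: measurable_sin_killed.
  by move=> w; exact: sin_max.
have ie m : P.-integrable setT (EFin \o escape m).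
  apply: (@finite_bounded_integrable R _ _ P _ 1) => // w.
  by rewrite /escape; case: ifP; rewrite ?sin_max// normr0.
have is_ m : P.-integrable setT (EFin \o stopped m).
  apply: integrable_EFinD; first exact: (integrable_EFinZl _ (iu m)).
  elim: m => [|m ihm].
    under eq_fun do rewrite big_ord0; exact: finite_measure_integrable_cst.
  under eq_fun do rewrite big_ord_recr/=.
  by apply: integrable_EFinD => //; exact: (integrable_EFinZl _ (ie m)).
have E w : stopped n.+1 w =
    stopped n w + (growth (tt n.+1) * (u n.+1 w + escape n w) + - growth (tt n) * u n w).
  by rewrite /stopped big_ord_recr/= /u; ring.
under eq_Rintegral do rewrite E.
have iue : P.-integrable setT (EFin \o (fun w => u n.+1 w + escape n w)).
  exact: (integrable_EFinD (iu n.+1) (ie n)).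
have i1 := integrable_EFinZl (growth (tt n.+1)) iue.
have i2 := integrable_EFinZl (- growth (tt n)) (iu n).
rewrite RintegralD//; last exact: (integrable_EFinD i1 i2).
rewrite ih RintegralD//.
rewrite !RintegralZl// RintegralD// /u integral_escape mulrA.
rewrite (_ : growth _ * decay _ = growth (tt n)); first by ring.
by rewrite /growth /decay -expRD; congr expR; field.
Qed.

Lemma killed_in n w : a < x < b -> killed n w != a -> a < killed n w < b.
Proof.
move=> axb; case: n => [//|n] /=; rewrite /kill_step; case: ifP => [/andP[]//|].
by rewrite eqxx.
Qed.

Lemma killed_pos n w : a < x < b ->
  (forall i, (i <= n)%N -> a < x + (B (tt i) w - B 0 w) < b) ->
  killed n w = x + (B (tt n) w - B 0 w).
Proof.
move=> axb; elim: n => [_|n ih h]; first by rewrite tt0 subrr addr0.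
have hn := ih (fun i ni => h i (leqW ni)).
have := h n.+1 (leqnn _); have /andP[hna _] := h n (leqnSn _).
rewrite /= hn /kill_step (gt_eqF hna)/= /increment.
have -> : x + (B (tt n) w - B 0 w) + (B (tt n.+1) w - B (tt n) w) =
  x + (B (tt n.+1) w - B 0 w) by ring.
by move=> ->.
Qed.

Lemma killed_exit n w : a < x < b ->
  (exists2 i, (i <= n)%N & ~~ (a < x + (B (tt i) w - B 0 w) < b)) -> killed n w = a.
Proof.
move=> axb; elim: n => [|n ih].
  by move=> [i]; rewrite leqn0 => /eqP->; rewrite tt0 subrr addr0 axb.
have [[i ni hi] _|hn] := pselect (exists2 i, (i <= n)%N & ~~ (a < x + (B (tt i) w - B 0 w) < b)).
  by rewrite /= /kill_step ih ?eqxx//; exists i.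
have hn' i : (i <= n)%N -> a < x + (B (tt i) w - B 0 w) < b.
  by move=> ni; apply: contrapT => /negP hi; apply: hn; exists i.
move=> [i]; rewrite leq_eqVlt ltnS => /predU1P[->|ni]; last by rewrite hn'.
rewrite /= (killed_pos axb hn') /kill_step /increment.
have -> : x + (B (tt n) w - B 0 w) + (B (tt n.+1) w - B (tt n) w) =
  x + (B (tt n.+1) w - B 0 w) by ring.
by move=> /negbTE ->; rewrite andbF.
Qed.

(** The eigenfunction vanishes at [a] and at [b] and is [|th|]-Lipschitz, while the overshoot past
    the boundary is at most the last increment. *)
Lemma norm_escape_le n w : a < x < b -> sin (th * (b - a)) = 0 ->
  `|escape n w| <= `|th| * `|increment n w|.
Proof.
move=> axb sb0; rewrite /escape; case: ifP => [/andP[ka out]|_]; last first.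
  by rewrite normr0 mulr_ge0.
have /andP[ak kb] := killed_in axb ka.
set y := killed n w; set z := increment n w; rewrite -/y -/z in ak kb out *.
rewrite -normrM.
move: out; rewrite negb_and -!leNgt => /orP[ya|yb].
  rewrite -[X in `|X|]subr0 -sin0; apply: (le_trans (norm_sinB_le _ _)).
  rewrite subr0 !normrM ler_wpM2l// ler0_norm ?subr_le0// (ler0_norm (_ : z <= 0)); lra.
rewrite -[X in `|X|]subr0 -sb0; apply: (le_trans (norm_sinB_le _ _)).
rewrite -mulrBr !normrM ler_wpM2l// ger0_norm ?(ger0_norm (_ : 0 <= z)); lra.
Qed.

(** A path escapes at most once, so a single [eta] appears whatever the number of steps. This is
    what makes the error vanish under grid refinement. *)
Lemma norm_sum_escape_le (eta : R) n w : 0 <= eta ->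
  (forall j, (j < n)%N -> `|escape j w| <= eta) -> a < x < b ->
  `|\sum_(j < n) growth (tt j.+1) * escape j w| <= growth (tt n) * eta.
Proof.
move=> eta0 + axb.
have gnd i : growth (tt i) <= growth (tt i.+1).
  rewrite ler_expR ler_pM2r ?invr_gt0// ler_wpM2l ?sqr_ge0//.
(* Strengthened for the induction: while the walk is alive the sum is exactly 0, so an escape always
   adds to nothing. *)
suff : (forall j, (j < n)%N -> `|escape j w| <= eta) ->
    `|\sum_(j < n) growth (tt j.+1) * escape j w| <=
    if killed n w == a then growth (tt n) * eta else 0.
  move=> h /h /le_trans; apply; case: ifP => // _.
  by rewrite mulr_ge0 ?expR_ge0.
elim: n => [_|n ih h]; first by rewrite big_ord0 normr0; case: ifP => // _; rewrite mulr_ge0 ?expR_ge0.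
have {}ih := ih (fun j nj => h j (leqW nj)).
rewrite big_ord_recr/= {2}/escape /kill_step.
have [ka|ka] := eqVneq (killed n w) a.
  rewrite /= eqxx mulr0 addr0; move: ih; rewrite ka eqxx => /le_trans; apply.
  by rewrite ler_wpM2r.
have s0 : \sum_(j < n) growth (tt j.+1) * escape j w = 0.
  by apply/eqP; rewrite -normr_le0; move: ih; rewrite (negbTE ka).
rewrite s0 add0r /=.
have [inab|outab] := boolP (a < killed n w + increment n w < b); rewrite /=.
  by rewrite mulr0 normr0; case: ifP => // _; rewrite mulr_ge0 ?expR_ge0.
rewrite eqxx normrM ger0_norm ?expR_ge0// ler_wpM2l ?expR_ge0//.
by have := h n (ltnSn n); rewrite /escape ka outab.
Qed.

End KilledChain.

(** * Passage to the limit along dyadic grids *)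

Lemma pow2V_cvg0 (R : realType) : (2 ^- n : R) @[n --> \oo] --> 0.
Proof.
under eq_fun do rewrite -exprVn.
apply: cvg_expr; rewrite ger0_norm ?invr_ge0// invf_lt1// ltr1n.
Unshelve. all: by [].
Qed.

Lemma near_pow2V_lt (R : realType) (e : R) : 0 < e -> \forall n \near \oo, 2 ^- n < e.
Proof.
move=> e0; have /cvgrPdist_lt/(_ _ e0) := @pow2V_cvg0 R.
by apply: filterS => n; rewrite sub0r normrN ger0_norm.
Qed.

(** Uniform continuity by compactness of [0, t]. Only [u] is confined to the segment, so the path is
    compared across the endpoint t as well. *)
Lemma unif_continuous_segment (R : realType) (f : R -> R) (t e : R) :
  {within `[0, +oo[, continuous f} -> 0 < e ->
  \forall n \near \oo, forall u v, 0 <= u <= t -> 0 <= v ->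
    `|v - u| <= 2 ^- n -> `|f v - f u| <= e.
Proof.
move=> cf e0.
have e20 : 0 < e / 2 by rewrite divr_gt0.
have /compact_near_coveringP nc := @segment_compact R 0 t.
pose Q n (u : R) := forall v, 0 <= u -> 0 <= v ->
  `|v - u| <= 2 ^- n -> `|f v - f u| <= e.
have : \forall n \near \oo, `[0, t]%classic `<=` Q n.
  apply: (nc nat \oo Q) => z; rewrite /= in_itv/= => /andP[z0 zt].
  have /subspace_continuousP/(_ z) := cf.
  rewrite /= in_itv/= andbT => /(_ z0)/cvgrPdist_lt/(_ _ e20).
  rewrite near_withinE => -[/= r r0 rf].
  have r20 : 0 < r / 2 by rewrite divr_gt0.
  near=> u n => v u0 v0 vu.
  have zu : `|z - u| < r / 2 by near: u; exact: (nbhsx_ballx z).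
  have nr : 2 ^- n < r / 2 by near: n; exact: near_pow2V_lt.
  have zv : `|z - v| < r.
    rewrite (_ : z - v = (z - u) - (v - u)); last by ring.
    by rewrite (le_lt_trans (ler_normB _ _))// [ltRHS]splitr ltr_leD// (le_trans vu)// ltW.
  have fu : `|f z - f u| < e / 2.
    by apply: rf; rewrite /= ?in_itv/= ?u0// (lt_le_trans zu)// ler_pdivrMr// ler_pMr// ler1n.
  have fv : `|f z - f v| < e / 2 by apply: rf; rewrite /= ?in_itv/= ?v0.
  rewrite (_ : f v - f u = (f z - f u) - (f z - f v)); last by ring.
  by rewrite (le_trans (ler_normB _ _))// [leRHS]splitr lerD// ltW.
apply: filterS => n h u v /andP[u0 ut] v0; apply: (h u) => //.
by rewrite /= in_itv/= u0.
Unshelve. all: end_near. Qed.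

Section DyadicLimit.
Context d (T : measurableType d) (R : realType) (P : probability T R).
Variables (x : R) (B : R -> {RV P >-> R}).
Hypothesis hB : brownian_motion x B.

(* Almost surely [B u w]; starting exactly at [x] spares a null set. *)
Definition position (u : R) (w : T) : R := x + (B u w - B 0 w).

Variables (a b : R).

Definition inside (u : R) : set T := [set w | a < position u w < b].

(** Dyadic times make the event a countable intersection, hence measurable. For a continuous path it
    still allows contact with the boundary at other times. *)
Definition dyadic_inside (t : R) : set T :=
  [set w | forall n j : nat, j%:R / 2 ^+ n <= t -> inside (j%:R / 2 ^+ n) w].

Lemma measurable_position u : measurable_fun setT (position u).
Proof. by apply: measurable_funD => //; exact: measurable_funB. Qed.

Lemma measurable_inside u : measurable (inside u).
Proof.
rewrite (_ : inside u = position u @^-1` `]a, b[); last first.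
  by apply/seteqP; split => w /=; rewrite /inside/= in_itv.
by rewrite -[X in measurable X]setTI; exact: measurable_position.
Qed.

Lemma measurable_dyadic_inside t : measurable (dyadic_inside t).
Proof.
rewrite (_ : dyadic_inside t = \bigcap_n \bigcap_j
    (if j%:R / 2 ^+ n <= t then inside (j%:R / 2 ^+ n) else setT)); last first.
  apply/seteqP; split => w h.
    by move=> n _ j _; case: ifP => // jt; exact: h.
  by move=> n j jt; have := h n I j I; rewrite jt.
apply: bigcapT_measurable => n; apply: bigcapT_measurable => j.
by case: ifP => // _; exact: measurable_inside.
Qed.

Variable t : R.
Hypothesis t0 : 0 <= t.

(** Capping at [t] puts [t], which need not be dyadic, on every grid. It is reached at index [M n]
    at the latest since [K > t], and the grid is constant afterwards. *)
Let grid (n j : nat) : R := Num.min (j%:R / 2 ^+ n) t.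
Let K := Num.Def.archi_bound t.
Let M (n : nat) : nat := (2 ^ n * K)%N.

Let grid0 n : grid n 0 = 0. Proof. by rewrite /grid mul0r min_l. Qed.

Let le_grid n i j : (i <= j)%N -> grid n i <= grid n j.
Proof.
move=> ij; rewrite /grid le_min !ge_min lexx orbT andbT; apply/orP; left.
by rewrite ler_pM2r ?ler_nat// invr_gt0 exprn_gt0.
Qed.

Let gridM n : grid n (M n) = t.
Proof.
rewrite /grid min_r// /M natrM natrX mulrAC mulfV ?mul1r ?expf_neq0//.
exact: ltW (archi_boundP t0).
Qed.

Let grid_step n j : `|grid n j.+1 - grid n j| <= 2 ^- n.
Proof.
have p0 : 0 < (2 ^- n : R) by rewrite invr_gt0 exprn_gt0.
rewrite ger0_norm ?subr_ge0 ?le_grid// /grid -natr1 mulrDl mul1r.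
by case: (leP (_ / _) t); case: (leP (_ + _) t); lra.
Qed.

Let grid_ge0 n j : 0 <= grid n j <= t.
Proof. by rewrite -(grid0 n) le_grid//= /grid ge_min lexx orbT. Qed.

Hypothesis axb : a < x < b.

(** The dyadic grids are nested: an exit seen at [j / 2 ^ m] is seen again at index
    [j * 2 ^ (n - m)] of every finer grid, so the killed position is eventually constant in [n]. *)
Let killed_grid w : \forall n \near \oo,
  killed x B (grid n) a b (M n) w =
  if w \in dyadic_inside t `&` inside t then position t w else a.
Proof.
have [/[!inE] -[dw iw]|] := boolP (w \in _).
  near=> n; rewrite (killed_pos (grid0 n) axb) ?gridM// => i iM.
  by rewrite /grid minEle; case: ifP => [le_it|_]; [exact: dw|exact: iw].
rewrite notin_setE => /not_andP[|niw].
  move=> /existsNP[m /existsNP[j /not_implyP[jt nin]]].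
  near=> n; apply: (killed_exit (grid0 n) axb).
  have mn : (m <= n)%N by near: n; exact: nbhs_infty_ge.
  have E : (j * 2 ^ (n - m))%:R / 2 ^+ n = j%:R / 2 ^+ m :> R.
    rewrite natrM natrX -[in X in _ / X](subnK mn) exprD invfM mulrA mulfK// expf_neq0.
  exists (j * 2 ^ (n - m))%N; last by rewrite /grid E min_l//; apply/negP.
  rewrite -(ler_nat R) -(ler_pM2r (_ : 0 < (2 ^+ n)^-1)) ?invr_gt0 ?exprn_gt0// E.
  rewrite (le_trans jt)// /M natrM natrX mulrAC mulfV ?mul1r ?expf_neq0//.
  exact: ltW (archi_boundP t0).
near=> n; apply: (killed_exit (grid0 n) axb); exists (M n) => //.
by rewrite gridM; apply/negP.
Unshelve. all: end_near. Qed.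

Variable th : R.
Hypothesis sin_th0 : sin (th * (b - a)) = 0.

Let S n := stopped x B (grid n) a b th (M n).
Let G := expR (th ^+ 2 * t / 2).
Let killed_limit w := if w \in dyadic_inside t `&` inside t then position t w else a.

Let S_near (eta : R) n w : 0 <= eta ->
  (forall j, `|escape x B (grid n) a b th j w| <= eta) ->
  `|S n w - G * sin (th * (killed x B (grid n) a b (M n) w - a))| <= G * eta.
Proof.
move=> eta0 h; rewrite /S /stopped gridM -/G addrC addKr /G.
rewrite -[X in _ <= expR (_ * X / _) * _](gridM n).
by apply: norm_sum_escape_le => // i; exact: le_grid.
Qed.

Let norm_S_le n w : `|S n w| <= G + G.
Proof.
have : `|S n w - G * sin (th * (killed x B (grid n) a b (M n) w - a))| <= G * 1.
  by apply: S_near => // j; rewrite /escape; case: ifP => _; rewrite ?sin_max// normr0.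
rewrite mulr1 -[X in `|X| <= _ + _](subrK (G * sin (th * (killed x B (grid n) a b (M n) w - a)))).
move=> h; apply: (le_trans (ler_normD _ _)); rewrite lerD//.
by rewrite normrM ger0_norm ?expR_ge0// ler_piMr ?expR_ge0// sin_max.
Qed.

Let S_cvg w : {within `[0, +oo[, continuous (fun u : R => B u w)} ->
  S n w @[n --> \oo] --> G * sin (th * (killed_limit w - a)).
Proof.
move=> cBw; apply/cvgrPdist_le => /= e e0.
(* The [+ 1] keeps [C] positive when [th = 0]. *)
pose C := G * (`|th| + 1).
have C0 : 0 < C by rewrite mulr_gt0 ?expR_gt0// ltr_wpDl.
have eC0 : 0 < e / C by rewrite divr_gt0.
have uc := unif_continuous_segment t cBw eC0.
near=> n.
have <- : killed x B (grid n) a b (M n) w = killed_limit w by near: n; exact: killed_grid.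
have h j : `|B (grid n j.+1) w - B (grid n j) w| <= e / C.
  have /(_ (grid n j) (grid n j.+1)) : forall u v, 0 <= u <= t -> 0 <= v ->
    `|v - u| <= 2 ^- n -> `|B v w - B u w| <= e / C by near: n; exact: uc.
  by have /andP[g0 _] := grid_ge0 n j.+1; apply.
have eta0 : 0 <= `|th| * (e / C) by rewrite mulr_ge0// ltW.
rewrite distrC; apply: (le_trans (S_near eta0 _)).
  move=> j; have := @norm_escape_le _ _ _ _ _ B (grid n) a b th j w axb sin_th0; move/le_trans; apply.
  by rewrite ler_wpM2l//; exact: h.
rewrite (_ : G * _ = e * (G * `|th| / C)); last by ring.
by rewrite ler_piMr ?ltW// ltr_pdivrMr// mul1r ltr_pM2l ?expR_gt0// ltrDl.
Unshelve. all: end_near. Qed.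

(** [integral_stopped] is constant in the grid. Along a continuous path the escape terms tend to 0
    with the mesh and [S] stays below [2 G], so dominated convergence leaves only the surviving
    part. *)
Lemma integral_sin_inside :
  \int[P]_w (\1_(dyadic_inside t `&` inside t) w * sin (th * (position t w - a))) =
  expR (- (th ^+ 2 * t / 2)) * sin (th * (x - a)).
Proof.
have mA : measurable (dyadic_inside t `&` inside t).
  by apply: measurableI; [exact: measurable_dyadic_inside|exact: measurable_inside].
pose f w := \1_(dyadic_inside t `&` inside t) w * sin (th * (position t w - a)).
have fE w : sin (th * (killed_limit w - a)) = f w.
  rewrite /f /killed_limit indicE; case: ifP => _; rewrite ?mul1r// subrr mulr0 sin0 mul0r//.
have mf : measurable_fun setT f.
  apply: measurable_funM; first exact: measurable_indic.
  apply: (measurableT_comp (@measurable_sin R)); apply: measurable_funM => //.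
  by apply: measurable_funB => //; exact: measurable_position.
have mS n : measurable_fun setT (S n) by exact: measurable_stopped.
have [|||||_ _] := @dominated_convergence _ _ R P setT measurableT (fun n w => (S n w)%:E)
  (fun w => (G * f w)%:E) (cst (G + G)%:E).
- by move=> n; exact/measurable_EFinP.
- by apply/measurable_EFinP; exact: measurable_funM.
- apply: filterS (bm_continuous hB) => w cBw _.
  by apply: cvg_EFin; [exact: nearW|rewrite -fE; exact: S_cvg].
- exact: finite_measure_integrable_cst.
- by apply: aeW => w n _; rewrite lee_fin norm_S_le.
move=> cv.
have ES n : \int[P]_w S n w = sin (th * (x - a)).
  by apply: (integral_stopped hB (grid0 n)) => // i; exact: le_grid.
have fi : P.-integrable setT (EFin \o f).
  apply: (@finite_bounded_integrable R _ _ P _ 1) => // w.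
  rewrite /f normrM; apply: le_trans (_ : 1 * 1 <= 1); last by rewrite mulr1.
  by rewrite ler_pM// ?sin_max// indicE; case: (_ \in _); rewrite ?normr1 ?normr0.
have e : G * \int[P]_w f w = sin (th * (x - a)).
  rewrite -RintegralZl// /Rintegral -(cvg_lim _ cv)//.
  rewrite (_ : (fun n => _) = cst (sin (th * (x - a)))%:E); first by rewrite lim_cst.
  apply/funext => n; rewrite -(ES n) /Rintegral fineK//.
  apply: integrable_fin_num => //.
  by apply: (@finite_bounded_integrable R _ _ P _ (G + G)) => // w; exact: norm_S_le.
rewrite -e mulrA /G -expRD addrC subrr expR0 mul1r//.
Qed.
End DyadicLimit.

(** * Square waves and the Clausen function *)

Lemma is_derive1X (R : realType) n (x : R) :
  is_derive x (1 : R) (fun y => y ^+ n.+1) (n.+1%:R * x ^+ n).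
Proof.
elim: n => [|n ih].
  by under eq_fun do rewrite expr1; rewrite mulr1; exact: is_derive_id.
under eq_fun do rewrite exprS.
apply: (is_derive_eq (is_derive1M (is_derive_id x 1) ih)).
by rewrite mul1r mulrCA -exprS -[n.+2%:R]natr1 mulrDl mul1r addrC.
Qed.

Lemma is_derive1V (R : realType) (f : R -> R) (x a : R) : f x != 0 ->
  is_derive x (1 : R) f a -> is_derive x (1 : R) (fun y => (f y)^-1) (- a / f x ^+ 2).
Proof.
move=> f0 df; apply: (is_derive_eq (is_deriveV f0 df)).
by rewrite /GRing.scale/= mulNr mulrC mulNr.
Qed.

Section TrigonometricSums.
Context {R : realType}.
Implicit Types (x y : R) (n k : nat).

Definition odd_real (k : nat) : R := 2 * k%:R + 1.

Lemma odd_real_gt0 k : 0 < odd_real k.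
Proof. by rewrite ltr_wpDl// mulr_ge0. Qed.

Lemma odd_real_neq0 k : odd_real k != 0. Proof. by rewrite gt_eqF// odd_real_gt0. Qed.

(** The sum telescopes, since [2 sin x cos ((2 k + 1) x) = sin ((2 k + 2) x) - sin (2 k x)]. *)
Lemma sum_cos_odd n x :
  2 * sin x * (\sum_(k < n) cos (odd_real k * x)) = sin (2 * n%:R * x).
Proof.
elim: n => [|n ih]; first by rewrite big_ord0 !mulr0 mul0r sin0.
rewrite big_ord_recr/= mulrDr ih /odd_real.
have -> : 2 * n%:R * x = (2 * n%:R + 1) * x - x by ring.
have -> : 2 * n.+1%:R * x = (2 * n%:R + 1) * x + x by rewrite -natr1; ring.
by rewrite sinB sinD; ring.
Qed.

Lemma sum_sin_odd n x :
  2 * sin x * (\sum_(k < n) sin (odd_real k * x)) = 1 - cos (2 * n%:R * x).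
Proof.
elim: n => [|n ih]; first by rewrite big_ord0 !mulr0 mul0r cos0 subrr.
rewrite big_ord_recr/= mulrDr ih /odd_real.
have -> : 2 * n%:R * x = (2 * n%:R + 1) * x - x by ring.
have -> : 2 * n.+1%:R * x = (2 * n%:R + 1) * x + x by rewrite -natr1; ring.
by rewrite cosB cosD; ring.
Qed.

Lemma sin_natpi n : sin (n%:R * pi) = 0 :> R.
Proof.
elim: n => [|n ih]; first by rewrite mul0r sin0.
by rewrite -natr1 mulrDl mul1r sinD ih sinpi mul0r mulr0 addr0.
Qed.

Lemma cos_natpi n : cos (n%:R * pi) = (-1) ^+ n :> R.
Proof.
elim: n => [|n ih]; first by rewrite mul0r cos0.
by rewrite -natr1 mulrDl mul1r cosD ih sin_natpi cospi mul0r subr0 exprS mulrC.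
Qed.

Lemma sin_odd_pihalf k : sin (odd_real k * (pi / 2)) = (-1) ^+ k :> R.
Proof.
rewrite (_ : odd_real k * (pi / 2) = k%:R * pi + pi / 2); last by rewrite /odd_real; field.
by rewrite sinDpihalf cos_natpi.
Qed.

Lemma cos_odd_pihalf k : cos (odd_real k * (pi / 2)) = 0 :> R.
Proof.
rewrite (_ : odd_real k * (pi / 2) = k%:R * pi + pi / 2); last by rewrite /odd_real; field.
by rewrite cosDpihalf sin_natpi oppr0.
Qed.

Lemma sin_odd_piB k x : sin (odd_real k * (pi - x)) = sin (odd_real k * x).
Proof.
rewrite (_ : odd_real k * (pi - x) = (2 * k)%:R * pi + (pi - odd_real k * x)); last first.
  by rewrite /odd_real natrM; ring.
rewrite sinD sin_natpi mul0r add0r cos_natpi exprM sqrrN expr1n expr1n mul1r.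
by rewrite sinB sinpi cospi mul0r sub0r mulN1r opprK.
Qed.

Lemma sin_gt0_pihalf_le x : 0 < x <= pi / 2 -> 0 < sin x.
Proof.
move=> /andP[x0 xpi]; apply: sin_gt0_pi; rewrite x0/=.
by rewrite (le_lt_trans xpi)// ltr_pdivrMr// ltr_pMr ?pi_gt0// ltr1n.
Qed.

Lemma cos_ge0_pihalf_le x : 0 < x <= pi / 2 -> 0 <= cos x.
Proof.
move=> /andP[x0 xpi]; apply: cos_ge0_pihalf.
by rewrite xpi andbT (le_trans _ (ltW x0))// oppr_le0 divr_ge0// pi_ge0.
Qed.

(* The primitive of [cos y / (4 n sin y ^ 2)] is [- 1 / (4 n sin y)]. *)
Lemma oscillation_bound n (U c : R -> R) x : (0 < n)%N -> 0 < x <= pi / 2 ->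
  (forall y, x <= y <= pi / 2 ->
    is_derive y (1 : R) U (c y * (cos y / (4 * n%:R * sin y ^+ 2)))) ->
  (forall y, `|c y| <= 1) ->
  `|U x - U (pi / 2)| <= (4 * n%:R * sin x)^-1.
Proof.
move=> n0 /andP[x0 xpi] dU c1.
have nR : 0 < n%:R :> R by rewrite ltr0n.
pose V y := (4 * n%:R * sin y)^-1.
have yin y : x <= y <= pi / 2 -> 0 < y <= pi / 2.
  by move=> /andP[xy ->]; rewrite (lt_le_trans x0 xy).
have dV y : x <= y <= pi / 2 ->
    is_derive y (1 : R) V (- (cos y / (4 * n%:R * sin y ^+ 2))).
  move=> /yin yi; have s0 := sin_gt0_pihalf_le yi.
  have h0 : 4 * n%:R * sin y != 0 by rewrite gt_eqF// !mulr_gt0.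
  apply: (is_derive_eq (@is_derive1V _ (fun y => 4 * n%:R * sin y) y _ h0 (is_derive1Ml (4 * n%:R) (is_derive_sin y)))).
  by field; rewrite !gt_eqF.
have w0 y : x <= y <= pi / 2 -> 0 <= cos y / (4 * n%:R * sin y ^+ 2).
  move=> /yin yi; rewrite divr_ge0 ?cos_ge0_pihalf_le// !mulr_ge0// ?ler0n//.
  1,2: exact: ltW (sin_gt0_pihalf_le yi).
have h1 : U x - V x <= U (pi / 2) - V (pi / 2).
  apply: (@derive_ge0_le _ (fun y => U y - V y)
    (fun y => (c y + 1) * (cos y / (4 * n%:R * sin y ^+ 2)))) => // y yi.
    apply: (is_derive_eq (is_derive1B (dU y yi) (dV y yi))).
    by ring.
  by rewrite mulr_ge0 ?w0//; have := c1 y; rewrite ler_norml => /andP[]; lra.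
have h2 : - U x - V x <= - U (pi / 2) - V (pi / 2).
  apply: (@derive_ge0_le _ (fun y => - U y - V y)
    (fun y => (1 - c y) * (cos y / (4 * n%:R * sin y ^+ 2)))) => // y yi.
    apply: (is_derive_eq (is_derive1B (is_derive1N (dU y yi)) (dV y yi))).
    by ring.
  by rewrite mulr_ge0 ?w0//; have := c1 y; rewrite ler_norml => /andP[]; lra.
have V0 : 0 <= V (pi / 2).
  by rewrite invr_ge0 sin_pihalf mulr1 mulr_ge0.
by rewrite ler_norml; apply/andP; split; rewrite -/(V x); lra.
Qed.


Definition square_wave (n : nat) (x : R) : R :=
  \sum_(k < n) sin (odd_real k * x) / odd_real k.

Lemma is_derive_sin_odd k x :
  is_derive x (1 : R) (fun y => sin (odd_real k * y)) (odd_real k * cos (odd_real k * x)).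
Proof.
apply: (is_derive_eq (is_derive1_compf (is_derive_sin _)
  (is_derive1Ml (odd_real k) (is_derive_id x 1)))).
by rewrite mulr1 mulrC.
Qed.

Lemma is_derive_square_wave n x :
  is_derive x (1 : R) (square_wave n) (\sum_(k < n) cos (odd_real k * x)).
Proof.
apply: (@is_derive1_sum _ n (fun k y => sin (odd_real k * y) / odd_real k)
  (fun k y => cos (odd_real k * y))) => k.
apply: (is_derive_eq (is_derive1M (is_derive_sin_odd k x) (is_derive_cst (odd_real k)^-1 x 1))).
by rewrite /cst; field; exact: odd_real_neq0.
Qed.

Lemma square_wave_piB n x : square_wave n (pi - x) = square_wave n x.
Proof. by apply: eq_bigr => k _; rewrite sin_odd_piB. Qed.

(** The derivative of [square_wave n] is [sin (2 n y) / (2 sin y)]. Adding [W], the boundary term of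
    an integration by parts, leaves a derivative of the form required by [oscillation_bound]. The
    factor 3 counts the bound for [U] and those for [W] at the two ends. *)
Lemma square_wave_near n x : (0 < n)%N -> 0 < x <= pi / 2 ->
  `|square_wave n x - square_wave n (pi / 2)| <= 3 * (4 * n%:R * sin x)^-1.
Proof.
move=> n0 xi; have /andP[x0 xpi] := xi.
have nR : 0 < n%:R :> R by rewrite ltr0n.
pose W (y : R) := cos (2 * n%:R * y) * (4 * n%:R * sin y)^-1.
pose U y := square_wave n y + W y.
have sx := sin_gt0_pihalf_le xi.
have HU : `|U x - U (pi / 2)| <= (4 * n%:R * sin x)^-1.
  apply: (@oscillation_bound n U (fun y => - cos (2 * n%:R * y)) x) => //; last first.
    by move=> y; rewrite normrN cos_max.
  move=> y /andP[xy ypi].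
  have s0 : 0 < sin y by rewrite sin_gt0_pihalf_le// (lt_le_trans x0 xy).
  have h0 : 4 * n%:R * sin y != 0 by rewrite gt_eqF// !mulr_gt0.
  apply: (is_derive_eq (is_derive1D (is_derive_square_wave n y)
    (is_derive1M (is_derive1_compf (is_derive_cos _) (is_derive1Ml (2 * n%:R) (is_derive_id y 1)))
      (@is_derive1V _ (fun y => 4 * n%:R * sin y) y _ h0 (is_derive1Ml (4 * n%:R) (is_derive_sin y)))))).
  have -> : \sum_(k < n) cos (odd_real k * y) = sin (2 * n%:R * y) / (2 * sin y).
    by rewrite -sum_cos_odd; field; rewrite gt_eqF.
  by field; rewrite !gt_eqF.
have W_le y : 0 < sin y -> `|W y| <= (4 * n%:R * sin y)^-1.
  move=> s0; rewrite normrM [X in _ * X]ger0_norm; last by rewrite invr_ge0 !mulr_ge0 ?ltW.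
  by rewrite ler_piMl ?cos_max// invr_ge0 !mulr_ge0 ?ltW.
have W1 : `|W (pi / 2)| <= (4 * n%:R * sin x)^-1.
  apply: (le_trans (W_le _ _)); first by rewrite sin_pihalf.
  by rewrite lef_pV2 ?posrE ?mulr_gt0// ?sin_pihalf// ler_pM2l ?mulr_gt0// sin_le1.
rewrite (_ : _ - _ = (U x - U (pi / 2)) - W x + W (pi / 2)); last by rewrite /U; ring.
apply: (le_trans (ler_normD _ _)); apply: (le_trans (lerD (ler_normB _ _) W1)).
have := W_le _ sx; lra.
Qed.

(** At pi / 2 the sum is Leibniz's series for [atan 1], whose remainder is estimated by
    differentiating the truncated arctangent series. *)
Lemma square_wave_pihalf n : `|square_wave n (pi / 2) - pi / 4| <= (odd_real n)^-1.
Proof.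
pose f (y : R) := \sum_(k < n) (-1) ^+ k * y ^+ k.*2.+1 / odd_real k.
have f1 : square_wave n (pi / 2) = f 1.
  by apply: eq_bigr => k _; rewrite sin_odd_pihalf expr1n mulr1.
have f0 : f 0 = 0 by apply: big1 => k _; rewrite expr0n mulr0 mul0r.
have dX k (y : R) : is_derive y (1 : R) (fun y => y ^+ k.*2.+1) (odd_real k * y ^+ k.*2).
  apply: (is_derive_eq (is_derive1X k.*2 y)).
  by rewrite /odd_real -natr1 -mul2n natrM.
have df (y : R) : is_derive y (1 : R) f (\sum_(k < n) (- y ^+ 2) ^+ k).
  apply: (@is_derive1_sum _ n (fun k y => (-1) ^+ k * y ^+ k.*2.+1 / odd_real k)
    (fun k y => (- y ^+ 2) ^+ k) y) => k.
  apply: (is_derive_eq (is_derive1M (is_derive1Ml ((-1) ^+ k) (dX k y)) (is_derive_cst (odd_real k)^-1 y 1))).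
  rewrite /cst mulr0 addr0 [in RHS]exprNn -exprM mul2n.
  by field; exact: odd_real_neq0.
have geo (y : R) : (1 + y ^+ 2)^-1 - \sum_(k < n) (- y ^+ 2) ^+ k = (- y ^+ 2) ^+ n / (1 + y ^+ 2).
  have y1 : 1 + y ^+ 2 != 0 by rewrite gt_eqF// ltr_pwDl// sqr_ge0.
  have := subrX1 (- y ^+ 2) n; move/eqP; rewrite subr_eq => /eqP ->.
  by field.
have gle (y : R) : `|(- y ^+ 2) ^+ n / (1 + y ^+ 2)| <= y ^+ n.*2.
  have y1 : 1 <= 1 + y ^+ 2 by rewrite lerDl sqr_ge0.
  rewrite normrM normrX normrN (ger0_norm (sqr_ge0 y)) -exprM mul2n ler_piMr//.
    by rewrite exprn_even_ge0// odd_double.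
  by rewrite ger0_norm ?invr_ge0 ?invf_le1 ?(lt_le_trans ltr01 y1)// ltW// (lt_le_trans ltr01 y1).
(* The derivative of [atan - f] is at most [y ^+ n.*2] in absolute value, so [h c] is nondecreasing
   on [0, 1] for both c = 1 and c = -1, giving a two-sided bound. *)
pose h (c y : R) := y ^+ n.*2.+1 / odd_real n + c * (atan y - f y).
have hle c : `|c| <= 1 -> h c 0 <= h c 1.
  move=> c1; apply: (@derive_ge0_le _ (h c) (fun y => y ^+ n.*2 +
      c * ((1 + y ^+ 2)^-1 - \sum_(k < n) (- y ^+ 2) ^+ k))) => // y _.
    apply: (is_derive_eq (is_derive1D (is_derive1M (dX n y) (is_derive_cst (odd_real n)^-1 y 1))
      (is_derive1Ml c (is_derive1B (is_derive1_atan y) (df y))))).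
    rewrite /cst mulr0 addr0; congr (_ + _).
    by field; exact: odd_real_neq0.
  rewrite geo; set q := _ / _.
  have : `|c * q| <= y ^+ n.*2 by rewrite normrM; apply: le_trans (gle y); rewrite ler_piMl.
  by rewrite ler_norml => /andP[]; lra.
have := hle 1; have := hle (-1); rewrite normrN1 normr1 /h atan0 f0 atan1 -f1 expr0n/= expr1n.
rewrite !mul0r !subrr !mulr0 !addr0 !mul1r mulN1r => /(_ (lexx _)) a1 /(_ (lexx _)) a2.
by rewrite ler_norml; apply/andP; split; lra.
Qed.

Lemma norm_square_wave_le_linear n x : 0 <= x -> `|square_wave n x| <= n%:R * x.
Proof.
move=> x0; apply: (le_trans (ler_norm_sum _ _ _)).
rewrite -[n in leRHS]card_ord -sum1_card natr_sum mulr_suml; apply: ler_sum => k _.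
rewrite mul1r normrM normfV (gtr0_norm (odd_real_gt0 k)) ler_pdivrMr ?odd_real_gt0//.
have := norm_sinB_le (odd_real k * x) 0; rewrite sin0 !subr0 => /le_trans; apply.
by rewrite normrM gtr0_norm ?odd_real_gt0// ger0_norm// mulrC.
Qed.

(** Concavity: [sin y - 2 / pi * y] vanishes at both ends and its derivative decreases. The sign of
    the derivative at [x] tells which end to compare with. *)
Lemma sin_ge_chord x : 0 <= x <= pi / 2 -> 2 / pi * x <= sin x.
Proof.
move=> /andP[x0 xpi].
have pi0 : 0 < pi :> R by exact: pi_gt0.
have dh (y : R) : is_derive y (1 : R) (fun y => sin y - 2 / pi * y) (cos y - 2 / pi).
  apply: (is_derive_eq (is_derive1B (is_derive_sin y) (is_derive1Ml (2 / pi) (is_derive_id y 1)))).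
  by rewrite mulr1.
have cosle (u v : R) : 0 <= u -> u <= v -> v <= pi / 2 -> cos v <= cos u.
  move=> u0; rewrite le_eqVlt => /predU1P[->//|uv] vpi.
  by apply: ltW; rewrite ltr_cos// in_itv/=; apply/andP; split; lra.
rewrite -subr_ge0; have [c|c] := leP (2 / pi) (cos x).
  rewrite -[leLHS](_ : sin 0 - 2 / pi * 0 = 0 :> R); last by rewrite sin0 mulr0 subrr.
  apply: (@derive_ge0_le _ (fun y => sin y - 2 / pi * y) (fun y => cos y - 2 / pi)) => // y /andP[y0 yx].
  by rewrite subr_ge0 (le_trans c)// cosle.
have e0 : 2 / pi * (pi / 2) = 1 :> R by rewrite mulrA divfK ?gt_eqF// divff.
have : - (sin x - 2 / pi * x) <= - (sin (pi / 2) - 2 / pi * (pi / 2)).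
  apply: (@derive_ge0_le _ (fun y => - (sin y - 2 / pi * y)) (fun y => - (cos y - 2 / pi))) => // y.
  by move=> /andP[xy ypi]; rewrite oppr_ge0 subr_le0 (le_trans _ (ltW c))// cosle.
by rewrite sin_pihalf e0 subrr oppr0 oppr_le0.
Qed.

(** If [n x <= 1] the linear bound gives 1. Otherwise [n sin x >= 1 / 2], and the distance to the
    value at pi / 2 is at most 3 / 2, while that value is below pi / 4 + 1 < 2. *)
Lemma square_wave_bound n x : 0 <= x <= pi -> `|square_wave n x| <= 4.
Proof.
wlog xpi : x / x <= pi / 2.
  move=> h /andP[x0 xpi]; have [xp|px] := leP x (pi / 2); first by apply: h; rewrite ?x0.
  rewrite -square_wave_piB; apply: h; first by lra.
  by rewrite subr_ge0 xpi gerBl.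
move=> /andP[x0 _].
case: n => [|n]; first by rewrite /square_wave big_ord0 normr0.
have [nx|nx] := leP (n.+1%:R * x) 1.
  by apply: (le_trans (norm_square_wave_le_linear _ x0)); apply: (le_trans nx); rewrite ler1n.
have xp : 0 < x.
  by rewrite lt_neqAle x0 andbT; apply: contraTneq nx => <-; rewrite mulr0 ltr10.
have xi : 0 < x <= pi / 2 by rewrite xp.
have sx : x / 2 <= sin x.
  apply: le_trans (sin_ge_chord _); last by rewrite x0.
  rewrite mulrC ler_wpM2r// ler_pdivlMr ?pi_gt0//.
  by have := @pihalf_lt2 R; lra.
have n0 : 0 < n.+1%:R :> R by rewrite ltr0n.
have h : (4 * n.+1%:R * sin x)^-1 <= 2^-1.
  rewrite lef_pV2 ?posrE ?mulr_gt0 ?sin_gt0_pihalf_le//.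
  have : n.+1%:R * (x / 2) <= n.+1%:R * sin x by rewrite ler_pM2l.
  lra.
have := square_wave_near (ltn0Sn n) xi.
have := square_wave_pihalf n.+1.
have : (odd_real n.+1)^-1 <= 1 by rewrite invf_le1 ?odd_real_gt0// /odd_real lerDr mulr_ge0.
have := @pihalf_lt2 R; have := @pi_gt0 R.
move: h; set z := (4 * _ * _)^-1; set u := (odd_real _)^-1.
set s1 := square_wave _ _; set s2 := square_wave _ _; set q : R := pi.
by rewrite !ler_norml => ? ? ? ? /andP[? ?] /andP[? ?]; apply/andP; split; lra.
Qed.

Lemma odd_realV_cvg0 : (odd_real n)^-1 @[n --> \oo] --> 0.
Proof.
apply: (@squeeze_cvgr _ _ _ _ (cst 0) (fun n => n.+1%:R^-1)).
- near=> n; rewrite invr_ge0 ltW ?odd_real_gt0//= lef_pV2 ?posrE ?odd_real_gt0 ?ltr0n//.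
  by rewrite /odd_real -natr1 lerD2r ler_peMl// ler1n.
- exact: cvg_cst.
- exact: cvg_harmonic.
Unshelve. all: end_near. Qed.

Lemma square_wave_cvg x : 0 < x < pi -> square_wave n x @[n --> \oo] --> pi / 4.
Proof.
wlog xpi : x / x <= pi / 2.
  move=> h /andP[x0 xpi]; have [xp|px] := leP x (pi / 2); first by apply: h; rewrite ?x0.
  under eq_fun do rewrite -square_wave_piB; apply: h; first by lra.
  by rewrite subr_gt0 xpi gtrBl.
move=> /andP[x0 _].
have xi : 0 < x <= pi / 2 by rewrite x0.
have sx := sin_gt0_pihalf_le xi.
rewrite -cvg_shiftS; apply/subr_cvg0; apply: norm_cvg0.
apply: (@squeeze_cvgr _ _ _ _ (cst 0)
  (fun n => 3 * (4 * sin x)^-1 * n.+1%:R^-1 + (odd_real n.+1)^-1)).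
- near=> n; rewrite normr_ge0/=.
  have := square_wave_near (ltn0Sn n) xi.
  have := square_wave_pihalf n.+1.
  rewrite (_ : 3 * (4 * n.+1%:R * sin x)^-1 = 3 * (4 * sin x)^-1 * n.+1%:R^-1); last first.
    by rewrite !invfM; ring.
  set z := 3 * _ * _; set u := (odd_real _)^-1.
  set s1 := square_wave _ _; set s2 := square_wave _ _; set q : R := pi / 4.
  by rewrite !ler_norml => /andP[? ?] /andP[? ?]; apply/andP; split; lra.
- exact: cvg_cst.
- rewrite -[X in _ --> X](addr0 (0 : R)); apply: cvgD.
    by rewrite -[X in _ --> X](mulr0 (3 * (4 * sin x)^-1)); apply: cvgMr; exact: cvg_harmonic.
  by rewrite (cvg_shiftS (fun n => (odd_real n)^-1)); exact: odd_realV_cvg0.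
Unshelve. all: end_near. Qed.

End TrigonometricSums.

(** * The odd part of the Clausen function and its derivative *)

Section Clausen.
Context {R : realType}.
Implicit Types (x y u v : R) (n m k : nat).
Notation odd_real := (@odd_real R).

(** Partial sums of Phi. With Cl2 (y) = sum_k sin (k y) / k ^ 2 the classical Clausen function, the
    limit is (Cl2 (y) + Cl2 (pi - y)) / 2. *)
Definition clausen_sum (n : nat) (y : R) : R :=
  \sum_(k < n) sin (odd_real k * y) / odd_real k ^+ 2.

Definition clausen (y : R) : R := limn (clausen_sum ^~ y).

Lemma odd_real_sqrV_le k : (0 < k)%N -> (odd_real k ^+ 2)^-1 <= k%:R^-1 - k.+1%:R^-1.
Proof.
move=> k0; have kR : 0 < k%:R :> R by rewrite ltr0n.
have -> : k%:R^-1 - k.+1%:R^-1 = (k%:R * (k%:R + 1))^-1 :> R.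
  by rewrite -natr1; field; rewrite !gt_eqF// ltr_wpDl.
by rewrite lef_pV2 ?posrE ?exprn_gt0 ?odd_real_gt0 ?mulr_gt0 ?addr_gt0// /odd_real; nra.
Qed.

Lemma norm_clausen_term_le k y : `|sin (odd_real k * y) / odd_real k ^+ 2| <= (odd_real k ^+ 2)^-1.
Proof.
rewrite normrM normfV [`|_ ^+ 2|]ger0_norm ?sqr_ge0//.
by rewrite ler_piMl ?sin_max// invr_ge0 sqr_ge0.
Qed.

Lemma clausen_sum_tail m n y : (0 < m)%N -> (m <= n)%N ->
  `|clausen_sum n y - clausen_sum m y| <= m%:R^-1 - n%:R^-1.
Proof.
move=> m0; elim: n => [|n ih]; first by rewrite leqNgt m0.
rewrite leq_eqVlt ltnS => /predU1P[->|mn]; first by rewrite !subrr normr0.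
rewrite /clausen_sum big_ord_recr/= -/(clausen_sum n y) addrAC.
apply: (le_trans (ler_normD _ _)); apply: (le_trans (lerD (ih mn) (norm_clausen_term_le n y))).
have := odd_real_sqrV_le (leq_trans m0 mn).
by set a := _^-1; set b := m%:R^-1; set c := n%:R^-1; set e := n.+1%:R^-1; lra.
Qed.

Lemma clausen_sum_cvg y : clausen_sum n y @[n --> \oo] --> clausen y.
Proof.
apply: cauchy_cvg; apply: cauchy_exP => e e0.
have [m _ hm] : \forall m \near \oo, (m.+1%:R^-1 : R) < e.
  have /cvgrPdist_lt/(_ _ e0) := @cvg_harmonic R.
  by apply: filterS => n; rewrite sub0r normrN ger0_norm ?invr_ge0.
exists (clausen_sum m.+1 y); exists m.+1 => // n /= mn.
rewrite /ball/= distrC; apply: le_lt_trans (clausen_sum_tail y (ltn0Sn m) mn) _.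
by apply: le_lt_trans (hm m (leqnn m)); rewrite gerBl.
Qed.

(** The first [m] terms are bounded by [u] each, the others by the telescoping tail. Choosing [m] of
    order [1 / sqrt u] shows that Phi tends to 0 at 0. *)
Lemma norm_clausen_sum_le m n u : (0 < m)%N -> 0 <= u ->
  `|clausen_sum n u| <= m%:R * u + m%:R^-1.
Proof.
move=> m0 u0.
have lin k : `|clausen_sum k u| <= k%:R * u.
  apply: (le_trans (ler_norm_sum _ _ _)).
  rewrite -[k in leRHS]card_ord -sum1_card natr_sum mulr_suml; apply: ler_sum => i _.
  rewrite mul1r normrM normfV [`|_ ^+ 2|]ger0_norm ?sqr_ge0//.
  rewrite ler_pdivrMr ?exprn_gt0 ?odd_real_gt0//.
  have := norm_sinB_le (odd_real i * u) 0; rewrite sin0 !subr0 => /le_trans; apply.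
  rewrite normrM gtr0_norm ?odd_real_gt0// ger0_norm// mulrC ler_wpM2l// expr2.
  have o1 : 1 <= odd_real i by rewrite /odd_real lerDr mulr_ge0.
  by rewrite ler_peMl// (le_trans ler01).
have mV : 0 <= m%:R^-1 :> R by rewrite invr_ge0.
have [nm|mn] := leqP n m.
  apply: (le_trans (lin n)); rewrite -[leLHS]addr0 lerD// ler_wpM2r// ler_nat//.
rewrite -[clausen_sum n u](subrK (clausen_sum m u)) addrC.
apply: (le_trans (ler_normD _ _)); rewrite lerD// (le_trans (clausen_sum_tail u m0 (ltnW mn)))//.
by rewrite gerBl.
Qed.

Lemma norm_clausen_le m u : (0 < m)%N -> 0 <= u -> `|clausen u| <= m%:R * u + m%:R^-1.
Proof.
move=> m0 u0; have cv : `|clausen_sum n u| @[n --> \oo] --> `|clausen u|.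
  by apply: cvg_norm; exact: clausen_sum_cvg.
rewrite -(cvg_lim _ cv)//; apply: limr_le; first exact: cvgP cv.
by apply: nearW => n; exact: norm_clausen_sum_le.
Qed.

Lemma clausen_piB y : clausen (pi - y) = clausen y.
Proof.
rewrite /clausen; congr (limn _); apply/funext => n.
by apply: eq_bigr => k _; rewrite sin_odd_piB.
Qed.

Lemma clausen_pihalf : clausen (pi / 2) = catalan R.
Proof.
rewrite /clausen /catalan; congr (limn _); apply/funext => n.
by rewrite /series/= big_mkord; apply: eq_bigr => k _; rewrite sin_odd_pihalf.
Qed.

Lemma clausen0 : clausen 0 = 0.
Proof.
rewrite /clausen (_ : clausen_sum ^~ 0 = cst 0) ?lim_cst//.
by apply/funext => n; apply: big1 => k _; rewrite mulr0 sin0 mul0r.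
Qed.

Definition log_cot (y : R) : R := (ln (cos (y / 2)) - ln (sin (y / 2))) / 2.


Lemma is_derive_log_cot y : 0 < y < pi -> is_derive y (1 : R) log_cot (- (2 * sin y)^-1).
Proof.
move=> /andP[y0 ypi].
have s0 : 0 < sin (y / 2) by apply: sin_gt0_pihalf; apply/andP; split; lra.
have c0 : 0 < cos (y / 2) by apply: cos_gt0_pihalf; apply/andP; split; lra.
have dhalf : is_derive y (1 : R) (fun y => y / 2) (2^-1 : R).
  by apply: (is_derive_eq (is_derive1M (is_derive_id y 1) (is_derive_cst (2^-1 : R) y 1))); rewrite /cst; ring.
have dc : is_derive y (1 : R) (fun y => cos (y / 2)) (- sin (y / 2) * 2^-1).
  exact: is_derive1_compf dhalf.
have ds : is_derive y (1 : R) (fun y => sin (y / 2)) (cos (y / 2) * 2^-1).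
  exact: is_derive1_compf dhalf.
have dlc : is_derive y (1 : R) (fun y => ln (cos (y / 2))) ((cos (y / 2))^-1 * (- sin (y / 2) * 2^-1)).
  exact: (is_derive1_compf (is_derive1_ln c0) dc).
have dls : is_derive y (1 : R) (fun y => ln (sin (y / 2))) ((sin (y / 2))^-1 * (cos (y / 2) * 2^-1)).
  exact: (is_derive1_compf (is_derive1_ln s0) ds).
apply: (is_derive_eq (is_derive1M (is_derive1B dlc dls) (is_derive_cst (2^-1 : R) y 1))).
have -> : sin y = 2 * sin (y / 2) * cos (y / 2).
  rewrite [in LHS](_ : y = (y / 2) *+ 2); last by rewrite -mulr_natr; field.
  by rewrite sin_mulr2n -mulr_natl; ring.
rewrite /cst mulr0 addr0.
have e := cos2Dsin2 (y / 2).
rewrite (_ : _ * 2^-1 = - (cos (y / 2) ^+ 2 + sin (y / 2) ^+ 2) / (4 * (sin (y / 2) * cos (y / 2)))); last first.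
  by field; rewrite !gt_eqF.
by rewrite e; field; rewrite !gt_eqF.
Qed.

Lemma log_cot_pihalf : log_cot (pi / 2) = 0.
Proof.
rewrite /log_cot; suff -> : cos (pi / 2 / 2) = sin (pi / 2 / 2) :> R by rewrite subrr mul0r.
by rewrite -[RHS]cosBpihalf -[LHS]cosN; congr cos; field.
Qed.

Lemma is_derive_clausen_sum n y :
  is_derive y (1 : R) (clausen_sum n) (\sum_(k < n) cos (odd_real k * y) / odd_real k).
Proof.
apply: (@is_derive1_sum _ n (fun k y => sin (odd_real k * y) / odd_real k ^+ 2)
  (fun k y => cos (odd_real k * y) / odd_real k)) => k.
apply: (is_derive_eq (is_derive1M (is_derive_sin_odd k y) (is_derive_cst (odd_real k ^+ 2)^-1 y 1))).
by rewrite /cst; field; exact: odd_real_neq0.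
Qed.

(** Subtracting [log_cot] cancels the non-oscillating part of the derivative and [W] absorbs the
    oscillating one up to order 1 / n. All three terms of [U] vanish at pi / 2, so only two error
    terms remain. *)
Lemma derive_clausen_sum_near n x : (0 < n)%N -> 0 < x <= pi / 2 ->
  `|\sum_(k < n) cos (odd_real k * x) / odd_real k - log_cot x| <=
  2 * (4 * n%:R * sin x)^-1.
Proof.
move=> n0 xi; have /andP[x0 xpi] := xi.
have nR : 0 < n%:R :> R by rewrite ltr0n.
pose C (y : R) := \sum_(k < n) cos (odd_real k * y) / odd_real k.
pose W (y : R) := sin (2 * n%:R * y) * (4 * n%:R * sin y)^-1.
pose U y := C y - log_cot y - W y.
have sx := sin_gt0_pihalf_le xi.
have dC (y : R) : is_derive y (1 : R) C (- \sum_(k < n) sin (odd_real k * y)).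
  rewrite -sumrN; apply: (@is_derive1_sum _ n (fun k y => cos (odd_real k * y) / odd_real k)
    (fun k y => - sin (odd_real k * y))) => k.
  apply: (is_derive_eq (is_derive1M (is_derive1_compf (is_derive_cos _)
    (is_derive1Ml (odd_real k) (is_derive_id y 1))) (is_derive_cst (odd_real k)^-1 y 1))).
  by rewrite /cst; field; exact: odd_real_neq0.
have HU : `|U x - U (pi / 2)| <= (4 * n%:R * sin x)^-1.
  apply: (@oscillation_bound _ n U (fun y => sin (2 * n%:R * y)) x) => //; last first.
    by move=> y; rewrite sin_max.
  move=> y /andP[xy ypi].
  have y0 : 0 < y by rewrite (lt_le_trans x0 xy).
  have s0 : 0 < sin y by rewrite sin_gt0_pihalf_le// y0.
  have h0 : 4 * n%:R * sin y != 0 by rewrite gt_eqF// !mulr_gt0.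
  have yi : 0 < y < pi by have pi0 := @pi_gt0 R; apply/andP; split; lra.
  apply: (is_derive_eq (is_derive1B (is_derive1B (dC y) (is_derive_log_cot yi))
    (is_derive1M (is_derive1_compf (is_derive_sin _) (is_derive1Ml (2 * n%:R) (is_derive_id y 1)))
      (@is_derive1V _ (fun y => 4 * n%:R * sin y) y _ h0 (is_derive1Ml (4 * n%:R) (is_derive_sin y)))))).
  have -> : \sum_(k < n) sin (odd_real k * y) = (1 - cos (2 * n%:R * y)) / (2 * sin y).
    by rewrite -sum_sin_odd; field; rewrite gt_eqF.
  by field; rewrite !gt_eqF.
have Upi : U (pi / 2) = 0.
  rewrite /U log_cot_pihalf /W (_ : 2 * n%:R * (pi / 2) = n%:R * pi); last by field.
  rewrite sin_natpi mul0r !subr0; apply: big1 => k _.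
  by rewrite cos_odd_pihalf mul0r.
have W_le : `|W x| <= (4 * n%:R * sin x)^-1.
  rewrite normrM [X in _ * X]ger0_norm; last by rewrite invr_ge0 !mulr_ge0// ltW.
  by rewrite ler_piMl ?sin_max// invr_ge0 !mulr_ge0// ltW.
rewrite -/(C x) (_ : C x - log_cot x = (U x - U (pi / 2)) + W x); last by rewrite Upi /U; ring.
apply: (le_trans (ler_normD _ _)); apply: (le_trans (lerD HU W_le)).
by set z := _^-1; lra.
Qed.

Lemma sin_le_pihalf u v : 0 <= u -> u <= v -> v <= pi / 2 -> sin u <= sin v.
Proof.
move=> u0; rewrite le_eqVlt => /predU1P[->//|uv] vpi.
by apply: ltW; rewrite ltr_sin// in_itv/=; apply/andP; split; lra.
Qed.

(* [log_cot] is the derivative of [clausen] on ]0, pi / 2]. *)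
Lemma clausen_le_primitive (c : R) (psi dpsi : R -> R) u v : `|c| <= 1 ->
  0 < u -> u <= v -> v <= pi / 2 ->
  (forall y, u <= y <= v -> is_derive y (1 : R) psi (dpsi y)) ->
  (forall y, u <= y <= v -> c * log_cot y <= dpsi y) ->
  c * (clausen v - clausen u) <= psi v - psi u.
Proof.
move=> c1 u0 uv vpi dp Ldp.
have ui : 0 < u <= pi / 2 by rewrite u0 (le_trans uv).
have su := sin_gt0_pihalf_le ui.
have cv : c * (clausen_sum n.+1 v - clausen_sum n.+1 u) @[n --> \oo] --> c * (clausen v - clausen u).
  rewrite (cvg_shiftS (fun n => c * (clausen_sum n v - clausen_sum n u))).
  by apply: cvgMr; apply: cvgB; exact: clausen_sum_cvg.
have cb : psi v - psi u + (v - u) * (2 * (4 * sin u)^-1) * n.+1%:R^-1 @[n --> \oo] -->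
    psi v - psi u.
  rewrite -[X in _ --> X](addr0 (psi v - psi u)); apply: cvgD; first exact: cvg_cst.
  rewrite -[X in _ --> X](mulr0 ((v - u) * (2 * (4 * sin u)^-1))); apply: cvgMr.
  exact: cvg_harmonic.
apply: (ler_cvg_to cv cb); apply: nearW => n.
(* A linear slack [e * y] absorbs the gap between the derivative of the partial sum and [log_cot];
   as sine increases up to pi / 2, the gap on [u, v] is largest at [u]. It disappears as [n]
   grows. *)
pose e : R := 2 * (4 * n.+1%:R * sin u)^-1.
have : psi u + e * u - c * clausen_sum n.+1 u <= psi v + e * v - c * clausen_sum n.+1 v.
  apply: (@derive_ge0_le _ (fun y => psi y + e * y - c * clausen_sum n.+1 y)
    (fun y => dpsi y + e * 1 - c * (\sum_(k < n.+1) cos (odd_real k * y) / odd_real k))) => // y yuv.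
    apply: is_derive1B (is_derive1Ml c (is_derive_clausen_sum _ _)).
    by apply: is_derive1D (dp y yuv) _; exact: is_derive1Ml (is_derive_id y 1).
  have /andP[uy yv] := yuv.
  have yi : 0 < y <= pi / 2 by rewrite (lt_le_trans u0 uy) (le_trans yv).
  have near_y := derive_clausen_sum_near (ltn0Sn n) yi.
  have ye : 2 * (4 * n.+1%:R * sin y)^-1 <= e.
    rewrite ler_pM2l// lef_pV2 ?posrE ?mulr_gt0 ?sin_gt0_pihalf_le// ler_pM2l ?mulr_gt0//.
    by apply: sin_le_pihalf => //; [exact: ltW|exact: le_trans vpi].
  have := Ldp y yuv; move: near_y ye; set C := \sum_(k < _) _; set z := 2 * _^-1 => near_y ye.
  have : `|c * (C - log_cot y)| <= z.
    by rewrite normrM; apply: le_trans near_y; rewrite ler_piMl.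
  by rewrite ler_norml => /andP[]; lra.
rewrite (_ : (v - u) * (2 * (4 * sin u)^-1) * n.+1%:R^-1 = e * v - e * u); first by lra.
by rewrite /e !invfM; ring.
Qed.

End Clausen.

(** * Numerical bounds and behaviour at small angles *)

Section ClausenInequalities.
Context {R : realType}.
Implicit Types (x y u v : R) (n m k : nat).
Notation odd_real := (@odd_real R).
Notation clausen := (@clausen R).
Notation clausen_sum := (@clausen_sum R).
Notation log_cot := (@log_cot R).

(** The cubic Taylor polynomial of the exponential at 7 / 10 already exceeds 2. The bounds on ln 2,
    pi and G are chosen to suffice together for [pi ^ 2 ln 2 <= 8 G]. *)
Lemma ln2_le : ln 2 <= 7 / 10 :> R.
Proof.
have h1 (x : R) : 0 <= x -> 1 + x + x ^+ 2 / 2 <= expR x.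
  move=> x0; rewrite -subr_ge0.
  rewrite -[leLHS](_ : expR 0 - (1 + 0 + 0 ^+ 2 / 2) = 0 :> R); last first.
    by rewrite expR0 expr0n/= mul0r !addr0 subrr.
  apply: (@derive_ge0_le _ (fun y => expR y - (1 + y + y ^+ 2 / 2)) (fun y => expR y - (1 + y))) => // y _.
    apply: is_derive1B (is_derive_expR y) _.
    apply: (is_derive_eq (is_derive1D (is_derive1D (is_derive_cst (1 : R) y 1) (is_derive_id y 1))
      (is_derive1M (is_derive1X 1 y) (is_derive_cst (2^-1 : R) y 1)))).
    by rewrite /cst; field.
  by rewrite subr_ge0 expR_ge1Dx.
have h2 (x : R) : 0 <= x -> 1 + x + x ^+ 2 / 2 + x ^+ 3 / 6 <= expR x.
  move=> x0; rewrite -subr_ge0.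
  rewrite -[leLHS](_ : expR 0 - (1 + 0 + 0 ^+ 2 / 2 + 0 ^+ 3 / 6) = 0 :> R); last first.
    by rewrite expR0 !expr0n/= !mul0r !addr0 subrr.
  apply: (@derive_ge0_le _ (fun y => expR y - (1 + y + y ^+ 2 / 2 + y ^+ 3 / 6))
    (fun y => expR y - (1 + y + y ^+ 2 / 2))) => // y /andP[y0 _].
    apply: is_derive1B (is_derive_expR y) _.
    apply: (is_derive_eq (is_derive1D (is_derive1D (is_derive1D (is_derive_cst (1 : R) y 1) (is_derive_id y 1))
      (is_derive1M (is_derive1X 1 y) (is_derive_cst (2^-1 : R) y 1)))
      (is_derive1M (is_derive1X 2 y) (is_derive_cst (6^-1 : R) y 1)))).
    by rewrite /cst; field.
  by rewrite subr_ge0 h1.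
rewrite -ler_expR lnK ?posrE//; apply: le_trans (h2 _ _) => //.
by rewrite (_ : 1 + _ + _ + _ = 12013 / 6000 :> R); [lra|field].
Qed.

Lemma pi_le : pi <= 16 / 5 :> R.
Proof.
have s1 (x : R) : 0 <= x -> sin x <= x.
  move=> x0; have := norm_sinB_le x 0; rewrite sin0 !subr0 (ger0_norm x0).
  exact: le_trans (ler_norm _).
have c1 (x : R) : 0 <= x -> 1 - x ^+ 2 / 2 <= cos x.
  move=> x0; rewrite -subr_ge0.
  rewrite -[leLHS](_ : cos 0 - (1 - 0 ^+ 2 / 2) = 0 :> R); last first.
    by rewrite cos0 expr0n/= mul0r subr0 subrr.
  apply: (@derive_ge0_le _ (fun y => cos y - (1 - y ^+ 2 / 2)) (fun y => y - sin y)) => // y /andP[y0 _].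
    apply: (is_derive_eq (is_derive1B (is_derive_cos y) (is_derive1B (is_derive_cst (1 : R) y 1)
      (is_derive1M (is_derive1X 1 y) (is_derive_cst (2^-1 : R) y 1))))).
    by rewrite /cst; field.
  by rewrite subr_ge0 s1.
have s2 (x : R) : 0 <= x -> x - x ^+ 3 / 6 <= sin x.
  move=> x0; rewrite -subr_ge0.
  rewrite -[leLHS](_ : sin 0 - (0 - 0 ^+ 3 / 6) = 0 :> R); last first.
    by rewrite sin0 expr0n/= mul0r !subr0.
  apply: (@derive_ge0_le _ (fun y => sin y - (y - y ^+ 3 / 6)) (fun y => cos y - (1 - y ^+ 2 / 2))) => // y /andP[y0 _].
    apply: (is_derive_eq (is_derive1B (is_derive_sin y) (is_derive1B (is_derive_id y 1)
      (is_derive1M (is_derive1X 2 y) (is_derive_cst (6^-1 : R) y 1))))).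
    by rewrite /cst; field.
  by rewrite subr_ge0 c1.
have c2 (x : R) : 0 <= x -> cos x <= 1 - x ^+ 2 / 2 + x ^+ 4 / 24.
  move=> x0; rewrite -subr_ge0.
  rewrite -[leLHS](_ : 1 - 0 ^+ 2 / 2 + 0 ^+ 4 / 24 - cos 0 = 0 :> R); last first.
    by rewrite cos0 !expr0n/= !mul0r subr0 addr0 subrr.
  apply: (@derive_ge0_le _ (fun y => 1 - y ^+ 2 / 2 + y ^+ 4 / 24 - cos y) (fun y => sin y - (y - y ^+ 3 / 6))) => // y /andP[y0 _].
    apply: (is_derive_eq (is_derive1B (is_derive1D (is_derive1B (is_derive_cst (1 : R) y 1)
      (is_derive1M (is_derive1X 1 y) (is_derive_cst (2^-1 : R) y 1)))
      (is_derive1M (is_derive1X 3 y) (is_derive_cst (24^-1 : R) y 1))) (is_derive_cos y))).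
    by rewrite /cst; field.
  by rewrite subr_ge0 s2.
(* If pi exceeded 16 / 5 then cos (8 / 5) would be positive, but the quartic upper bound for the
   cosine is negative there. *)
rewrite leNgt; apply/negP => pi_gt.
have : 0 < cos (8 / 5 : R) by apply: cos_gt0_pihalf; apply/andP; split; lra.
apply/negP; rewrite -leNgt; apply: le_trans (c2 _ _) _ => //.
by rewrite (_ : 1 - _ + _ = - (13 / 1875) :> R); [lra|field].
Qed.

(** Even partial sums of an alternating series with decreasing terms increase, and the fourth is
    already above 9 / 10. *)
Lemma catalan_ge : 9 / 10 <= catalan R.
Proof.
rewrite -clausen_pihalf.
have cv : clausen_sum n (pi / 2) @[n --> \oo] --> clausen (pi / 2) by exact: clausen_sum_cvg.
rewrite -(cvg_lim _ cv)//; apply: limr_ge; first exact: cvgP cv.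
pose s n := clausen_sum n (pi / 2).
have sS n : s n.+1 = s n + (-1) ^+ n / odd_real n ^+ 2.
  by rewrite /s /clausen_sum big_ord_recr/= sin_odd_pihalf.
have s4 : 9 / 10 <= s 4.
  have -> : s 4 = 1 - 1 / 9 + 1 / 25 - 1 / 49.
    by rewrite !sS /s /clausen_sum big_ord0 /odd_real; field.
  lra.
have sgn m : (-1) ^+ m.*2 = 1 :> R by rewrite -mul2n exprM sqrrN !expr1n.
have odd_step m : s m.*2 <= s m.*2.+1.
  by rewrite sS sgn lerDl mulr_ge0// invr_ge0 sqr_ge0.
have even_step m : s m.*2 <= s m.+1.*2.
  rewrite doubleS !sS [(-1) ^+ _.+1]exprS sgn mulr1 -addrA lerDl mulN1r subr_ge0 mul1r.
  rewrite lef_pV2 ?posrE ?exprn_gt0 ?odd_real_gt0// lerXn2r ?nnegrE ?(ltW (odd_real_gt0 _))//.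
  by rewrite /odd_real lerD2r ler_pM2l// ler_nat.
have even_ge m : s 4 <= s m.+2.*2.
  by elim: m => [//|m ih]; apply: le_trans ih (even_step _).
exists 4 => // n /= n4; apply: (le_trans s4).
rewrite -/(s n) -(odd_double_half n).
have [m ->] : exists m, n./2 = m.+2.
  exists (n./2 - 2)%N; rewrite -addn2 subnK//.
  exact: half_leq n4.
by case: (odd n); [exact: le_trans (even_ge m) (odd_step _)|exact: even_ge].
Qed.


Lemma ln_le_self (x : R) : 0 < x -> ln x <= x.
Proof.
move=> x0; rewrite -ler_expR lnK ?posrE//.
by apply: le_trans (expR_ge1Dx x); rewrite lerDr.
Qed.

(* [2 / pi * half_xlog (pi * p) = p * ln p^-1]. *)
Definition half_xlog (y : R) : R := y / 2 * (ln pi - ln y).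

Lemma is_derive_half_xlog y : 0 < y ->
  is_derive y (1 : R) half_xlog ((ln pi - ln y - 1) / 2).
Proof.
move=> y0.
have dl : is_derive y (1 : R) (fun y => ln pi - ln y) (- y^-1).
  apply: (is_derive_eq (is_derive1B (is_derive_cst (ln pi) y 1) (is_derive1_ln y0))).
  by rewrite sub0r.
have dh : is_derive y (1 : R) (fun y => y / 2) (2^-1 : R).
  apply: (is_derive_eq (is_derive1M (is_derive_id y 1) (is_derive_cst (2^-1 : R) y 1))).
  by rewrite /cst; ring.
apply: (is_derive_eq (is_derive1M dh dl)).
by field; rewrite gt_eqF.
Qed.

(** At these points Phi and g are both O(1 / m): the square in the denominator balances the two
    terms of [norm_clausen_le] and gives [ln pi - ln u = 2 ln (m + 1)]. They stand in for the
    endpoint 0, where the derivatives are infinite. *)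
Lemma small_angle m : [/\ 0 < pi / m.+1%:R ^+ 2 :> R,
  `|clausen (pi / m.+1%:R ^+ 2)| <= (pi + 1) / m.+1%:R &
  0 <= half_xlog (pi / m.+1%:R ^+ 2) <= pi / m.+1%:R].
Proof.
set u := pi / m.+1%:R ^+ 2.
have m0 : 0 < m.+1%:R :> R by rewrite ltr0n.
have pi0 := @pi_gt0 R.
have u0 : 0 < u by rewrite divr_gt0// exprn_gt0.
split => //.
  apply: (le_trans (norm_clausen_le (ltn0Sn m) (ltW u0))).
  by rewrite /u le_eqVlt; apply/orP; left; apply/eqP; field; rewrite gt_eqF.
have uE : ln pi - ln u = 2 * ln m.+1%:R.
  rewrite /u ln_div ?posrE ?exprn_gt0// lnXn// -mulr_natl.
  by ring.
have l0 : 0 <= ln m.+1%:R :> R by rewrite ln_ge0// ler1n.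
rewrite /half_xlog uE mulr_ge0 ?divr_ge0 ?(ltW u0)//= ?mulr_ge0//.
rewrite (_ : u / 2 * (2 * ln m.+1%:R) = pi / m.+1%:R * (ln m.+1%:R / m.+1%:R)); last first.
  by rewrite /u; field; rewrite gt_eqF.
rewrite ler_piMr ?divr_ge0 ?(ltW pi0)// ?(ltW m0)// ler_pdivrMr// mul1r.
  exact: ln_le_self.
exact: ltW.
Qed.

End ClausenInequalities.

(* [lra] would otherwise unfold the definition of [pi]. *)
Ltac lra_pi := match goal with
  | R : realType |- _ => set (q_pi := @pi R) in *; clearbody q_pi; lra
  end.

(** * Comparison of Phi with g *)

Section ClausenBounds.
Context {R : realType}.
Implicit Types (x y u v : R) (n m k : nat).
Notation clausen := (@clausen R).
Notation log_cot := (@log_cot R).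
Notation half_xlog := (@half_xlog R).

Lemma near_small_angle (y : R) : 0 < y -> \forall m \near \oo, pi / m.+1%:R ^+ 2 <= y.
Proof.
move=> y0; have pi0 := @pi_gt0 R.
have yp : 0 < y / pi by rewrite divr_gt0.
have /cvgrPdist_lt/(_ _ yp) := @cvg_harmonic R; apply: filterS => m.
rewrite sub0r normrN ger0_norm ?invr_ge0// => h.
have m0 : 0 < m.+1%:R :> R by rewrite ltr0n.
rewrite ler_pdivrMr ?exprn_gt0// -ler_pdivrMl// mulrC.
have : m.+1%:R^-1 <= y / pi by exact: ltW.
rewrite -[leLHS]div1r ler_pdivrMr// => h2; apply: (@le_trans _ _ (pi / y * 1)); first by rewrite mulr1 mulrC.
rewrite -ler_pdivlMl ?divr_gt0// invf_div; apply: (le_trans h2).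
by rewrite ler_wpM2l ?(ltW yp)// expr2 ler_peMl ?(ltW m0)// ler1n.
Qed.

Lemma ge0_of_harmonic (K x : R) : (\forall m \near \oo, - (K / m.+1%:R) <= x) -> 0 <= x.
Proof.
move=> h; have cv : - (K / m.+1%:R) @[m --> \oo] --> 0.
  rewrite -oppr0 -(mulr0 K); apply: cvgN; apply: cvgMr; exact: cvg_harmonic.
by rewrite -(cvg_lim _ cv)//; apply: limr_le => //; exact: cvgP cv.
Qed.

(** Phi - g tends to 0 at 0 and its derivative is nonnegative. That derivative is itself
    nonincreasing, because [sin z <= z], and at pi / 2 it equals [(1 - ln 2) / 2 > 0]. *)
Lemma half_xlog_le_clausen y : 0 < y <= pi / 2 -> half_xlog y <= clausen y.
Proof.
move=> /andP[y0 ypi]; have pi0 := @pi_gt0 R.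
have slope z : 0 < z <= pi / 2 -> -1 * log_cot z <= - ((ln pi - ln z - 1) / 2).
  move=> /andP[z0 zpi].
  have : log_cot (pi / 2) - (ln pi - ln (pi / 2) - 1) / 2 <= log_cot z - (ln pi - ln z - 1) / 2.
    rewrite -lerN2.
    apply: (@derive_ge0_le _ (fun z => - (log_cot z - (ln pi - ln z - 1) / 2))
      (fun z => (2 * sin z)^-1 - (2 * z)^-1)) => // w /andP[zw wpi].
      have w0 : 0 < w by rewrite (lt_le_trans z0).
      have wi : 0 < w < pi by apply/andP; split; lra_pi.
      apply: (is_derive_eq (is_derive1N (is_derive1B (is_derive_log_cot wi)
        (is_derive1M (is_derive1B (is_derive1B (is_derive_cst (ln pi) w 1) (is_derive1_ln w0)) (is_derive_cst (1 : R) w 1))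
          (is_derive_cst (2^-1 : R) w 1))))).
      by rewrite /cst; field; rewrite !gt_eqF// sin_gt0_pi.
    have w0 : 0 < w by rewrite (lt_le_trans z0).
    have s0 : 0 < sin w by rewrite sin_gt0_pihalf_le// w0.
    rewrite subr_ge0 lef_pV2 ?posrE ?mulr_gt0// ler_pM2l//.
    have := norm_sinB_le w 0; rewrite sin0 !subr0 (ger0_norm (ltW w0)).
    exact: le_trans (ler_norm _).
  rewrite log_cot_pihalf ln_div ?posrE//; have := @ln2_le R; lra_pi.
rewrite -subr_ge0; apply: (@ge0_of_harmonic (2 * pi + 1)).
apply: filterS (near_small_angle y0) => m uy.
have [u0 cu /andP[gu0 gu]] := @small_angle R m.
have : -1 * (clausen y - clausen (pi / m.+1%:R ^+ 2)) <=
    - half_xlog y - - half_xlog (pi / m.+1%:R ^+ 2).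
  apply: (@clausen_le_primitive _ (-1) (fun z => - half_xlog z)
    (fun z => - ((ln pi - ln z - 1) / 2))) => //; first by rewrite normrN1.
    move=> z /andP[uz _]; apply: is_derive1N; apply: is_derive_half_xlog.
    exact: lt_le_trans uz.
  move=> z /andP[uz zy]; apply: slope.
  by rewrite (lt_le_trans u0 uz) (le_trans zy).
have : (2 * pi + 1) / m.+1%:R = (pi + 1) / m.+1%:R + pi / m.+1%:R :> R by ring.
move: cu gu0 gu; set U := clausen (pi / _); set V := half_xlog (pi / _).
set a := (2 * pi + 1) / _; set b := (pi + 1) / _; set c := pi / m.+1%:R.
by rewrite ler_norml => /andP[]; lra_pi.
Qed.

(** The derivative of Phi - g is at most 1 / 2, since [cos (z / 2) <= 1] and, by the chord bound,
    [sin (z / 2) >= z / pi]. The correction is negligible against g near 0, which yields sharpness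
    of the lower constant. *)
Lemma clausen_le_half_xlogD y : 0 < y <= pi / 2 -> clausen y <= half_xlog y + y / 2.
Proof.
move=> /andP[y0 ypi]; have pi0 := @pi_gt0 R.
have slope z : 0 < z <= pi / 2 -> 1 * log_cot z <= (ln pi - ln z - 1) / 2 + 2^-1.
  move=> /andP[z0 zpi].
  have : ln (cos (z / 2)) <= 0 by rewrite ln_le0// cos_le1.
  have : ln (z / pi) <= ln (sin (z / 2)).
    rewrite ler_ln ?posrE ?divr_gt0//; last first.
      by apply: sin_gt0_pihalf; apply/andP; split; lra_pi.
    have E (q : R) : q != 0 -> z / q = 2 / q * (z / 2) by move=> q0; field.
    rewrite (E pi) ?gt_eqF//.
    by apply: sin_ge_chord; apply/andP; split; lra_pi.
  by rewrite ln_div ?posrE// /log_cot; lra_pi.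
rewrite -subr_ge0; apply: (@ge0_of_harmonic (3 * pi + 1)).
apply: filterS (near_small_angle y0) => m uy.
have [u0 cu /andP[gu0 gu]] := @small_angle R m.
have : 1 * (clausen y - clausen (pi / m.+1%:R ^+ 2)) <=
    half_xlog y + y / 2 - (half_xlog (pi / m.+1%:R ^+ 2) + (pi / m.+1%:R ^+ 2) / 2).
  apply: (@clausen_le_primitive _ 1 (fun z => half_xlog z + z / 2)
    (fun z => (ln pi - ln z - 1) / 2 + 2^-1)) => //; first by rewrite normr1.
    move=> z /andP[uz _].
    apply: (is_derive_eq (is_derive1D (is_derive_half_xlog (lt_le_trans u0 uz))
      (is_derive1M (is_derive_id z 1) (is_derive_cst (2^-1 : R) z 1)))).
    by rewrite /cst; ring.
  move=> z /andP[uz zy]; apply: slope.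
  by rewrite (lt_le_trans u0 uz) (le_trans zy).
have : (3 * pi + 1) / m.+1%:R = (pi + 1) / m.+1%:R + 2 * (pi / m.+1%:R) :> R by ring.
have : 0 <= pi / m.+1%:R :> R by rewrite divr_ge0// ltW.
move: cu gu0 gu; set U := clausen (pi / _); set V := half_xlog (pi / _).
set a := (3 * pi + 1) / _; set b := (pi + 1) / _; set c := pi / m.+1%:R.
set w := pi / m.+1%:R ^+ 2 in u0 *.
by rewrite ler_norml => /andP[]; lra_pi.
Qed.

(** The derivative of this difference has the sign of [z - C sin z], nonpositive because
    [sin z >= 2 z / pi]: here the condition [pi / 2 <= C] originates. *)
Lemma slope_gap_noninc (C u v : R) : pi / 2 <= C -> 0 < u -> u <= v -> v <= pi / 2 ->
  C * ((ln pi - ln v - 1) / 2) - log_cot v <= C * ((ln pi - ln u - 1) / 2) - log_cot u.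
Proof.
move=> Cpi u0 uv vpi; have pi0 := @pi_gt0 R; rewrite -lerN2.
pose f (z : R) := - (C * ((ln pi - ln z - 1) / 2) - log_cot z).
have le_f := @derive_ge0_le _ f (fun z => C / (2 * z) - (2 * sin z)^-1) u v uv.
rewrite -/(f u) -/(f v).
apply: le_f => w /andP[uw wv].
  have w0 : 0 < w by rewrite (lt_le_trans u0).
  have wi : 0 < w < pi by apply/andP; split; lra_pi.
  have s0 : sin w != 0 by rewrite gt_eqF// sin_gt0_pi.
  have w1 : w != 0 by rewrite gt_eqF.
  apply: (is_derive_eq (is_derive1N (is_derive1B (is_derive1Ml C
    (is_derive1M (is_derive1B (is_derive1B (is_derive_cst (ln pi) w 1) (is_derive1_ln w0)) (is_derive_cst (1 : R) w 1))
        (is_derive_cst (2^-1 : R) w 1))) (is_derive_log_cot wi)))).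
  rewrite /cst; move: (ln pi - ln w - 1) (sin w) s0 => q s s0.
  by field; rewrite s0 w1.
have w0 : 0 < w by rewrite (lt_le_trans u0).
have s0 : 0 < sin w by rewrite sin_gt0_pihalf_le// w0/=; lra_pi.
rewrite subr_ge0 -[leLHS]div1r ler_pdivrMr ?mulr_gt0//.
have -> : C / (2 * w) * (2 * sin w) = C * sin w / w.
  by move: (sin w) => s; field; rewrite gt_eqF.
rewrite ler_pdivlMr// mul1r.
have sw : 2 / pi * w <= sin w by apply: sin_ge_chord; apply/andP; split; lra_pi.
apply: (@le_trans _ _ (pi / 2 * sin w)); last by rewrite ler_pM2r.
by rewrite -ler_pdivrMl ?divr_gt0// invf_div.
Qed.

(* The difference of the two sides vanishes at both ends of [0, pi / 2], and its
   derivative, once negative, stays negative. *)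
Lemma clausen_le_scaled_half_xlog (C y : R) : pi / 2 <= C ->
  C * half_xlog (pi / 2) = clausen (pi / 2) ->
  0 < y <= pi / 2 -> clausen y <= C * half_xlog y.
Proof.
move=> Cpi hpi /andP[y0 ypi]; have pi0 := @pi_gt0 R.
pose slope (z : R) := (ln pi - ln z - 1) / 2.
have noninc (u v : R) : 0 < u -> u <= v -> v <= pi / 2 ->
  C * slope v - log_cot v <= C * slope u - log_cot u by exact: slope_gap_noninc.
have dpsi (z : R) : 0 < z -> is_derive z (1 : R) (fun z => C * half_xlog z) (C * slope z).
  by move=> z0; exact: is_derive1Ml (is_derive_half_xlog z0).
clearbody slope.
(* The sign of the derivative at [y] selects the end to integrate from: nonnegative at [y], it is so
   on all of ]0, y]; negative, it stays so up to pi / 2. *)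
have [r0|r0] := leP (log_cot y) (C * slope y); last first.
  have : -1 * (clausen (pi / 2) - clausen y) <= - (C * half_xlog (pi / 2)) - - (C * half_xlog y).
    apply: (@clausen_le_primitive _ (-1) (fun z => - (C * half_xlog z))
      (fun z => - (C * slope z))) => [|//|//|//|z /andP[yz _]|z /andP[yz zpi]].
    - by rewrite normrN1.
    - by apply: is_derive1N; apply: dpsi; exact: lt_le_trans yz.
    - have := noninc _ _ y0 yz zpi.
    by move: (C * slope z) (C * slope y) (log_cot z) (log_cot y) r0 => ? ? ? ?; lra.
  rewrite hpi; move: (clausen y) (clausen (pi / 2)) (C * half_xlog y) => ? ? ?; lra.
rewrite -subr_ge0; apply: (@ge0_of_harmonic (pi + 1 + C * pi)).
have C0 : 0 <= C by rewrite (le_trans _ Cpi)// divr_ge0// ltW.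
apply: filterS (near_small_angle y0) => m uy.
have [u0 cu /andP[gu0 gu]] := @small_angle R m.
have : 1 * (clausen y - clausen (pi / m.+1%:R ^+ 2)) <=
    C * half_xlog y - C * half_xlog (pi / m.+1%:R ^+ 2).
  apply: (@clausen_le_primitive _ 1 (fun z => C * half_xlog z)
    (fun z => C * slope z)) => [|//|//|//|z /andP[uz _]|z /andP[uz zy]].
  - by rewrite normr1.
  - by apply: dpsi; exact: lt_le_trans uz.
  - have := noninc _ _ (lt_le_trans u0 uz) zy ypi.
  by move: (C * slope z) (C * slope y) (log_cot z) (log_cot y) r0 => ? ? ? ?; lra.
have : (pi + 1 + C * pi) / m.+1%:R = (pi + 1) / m.+1%:R + C * (pi / m.+1%:R) :> R.
  by rewrite mulrDl mulrA.
have : 0 <= C * half_xlog (pi / m.+1%:R ^+ 2) by rewrite mulr_ge0.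
have : 0 <= C * (pi / m.+1%:R) by rewrite mulr_ge0// divr_ge0// ltW.
move: cu gu0 gu; rewrite ler_norml => /andP[].
move: (clausen (pi / m.+1%:R ^+ 2)) (C * half_xlog (pi / _)) => U V.
move: (clausen y) (C * half_xlog y) (C * (pi / _)) => cy hy Cp.
move: ((pi + 1 + C * pi) / _) ((pi + 1) / _) => a b.
by clear; lra.
Qed.

Lemma clausen_le_half_xlog y : 0 < y <= pi / 2 ->
  clausen y <= catalan R / (pi / 4 * ln 2) * half_xlog y.
Proof.
have pi0 := @pi_gt0 R; have l2 : 0 < ln 2 :> R by rewrite ln_gt0// ltr1n.
apply: clausen_le_scaled_half_xlog.
  rewrite ler_pdivlMr ?mulr_gt0//.
  (* The claim amounts to [pi ^ 2 ln 2 <= 8 G]; the rational bounds give 7.168 against 7.2. *)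
  have := @catalan_ge R; have := @pi_le R; have := @ln2_le R => l2u piu Gl.
  have p2 : pi ^+ 2 <= (16 / 5) ^+ 2 :> R by rewrite lerXn2r ?nnegrE ?(ltW pi0)//; lra_pi.
  have : pi ^+ 2 * ln 2 <= (16 / 5) ^+ 2 * (7 / 10) :> R by rewrite ler_pM// ?sqr_ge0 ?(ltW l2).
  lra_pi.
rewrite clausen_pihalf /half_xlog ln_div ?posrE//.
have E (G q l : R) : q != 0 -> l != 0 -> G / (q / 4 * l) * (q / 2 / 2 * l) = G.
  by move=> q0 l0; field; rewrite q0 l0.
by rewrite subKr E ?gt_eqF.
Qed.

End ClausenBounds.

(** * The law of the exit time *)

Lemma sum_odd_sqrV_le (R : realType) n : \sum_(k < n) ((@odd_real R k) ^+ 2)^-1 <= 2.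
Proof.
case: n => [|n]; first by rewrite big_ord0.
suff : \sum_(k < n.+1) ((@odd_real R k) ^+ 2)^-1 <= 2 - n.+1%:R^-1.
  by move=> /le_trans; apply; rewrite gerBl.
elim: n => [|n ih]; first by rewrite big_ord1 /odd_real mulr0 add0r expr1n invr1; lra.
rewrite big_ord_recr/=; apply: (le_trans (lerD ih (@odd_real_sqrV_le R _ (ltn0Sn n)))).
by move: (n.+1%:R^-1) (n.+2%:R^-1) => p q; lra.
Qed.

Lemma mul_expRN_le (R : realType) (c t : R) : 0 < c -> 0 <= t -> t * expR (- (c * t)) <= c^-1.
Proof.
move=> c0 t0; rewrite expRN ler_pdivrMr ?expR_gt0// mulrC -ler_pdivrMr ?invr_gt0//.
rewrite invrK mulrC; apply: le_trans (expR_ge1Dx _).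
by rewrite lerDr.
Qed.

Lemma continuous_gauss (R : realType) (c : R) : continuous (fun u : R => expR (- (c ^+ 2 * u ^+ 2 / 2))).
Proof.
move=> u; apply: continuous_comp; last exact: continuous_expR.
apply: cvgN; apply: cvgM; last exact: cvg_cst.
by apply: cvgM; [exact: cvg_cst|exact: exprn_continuous].
Qed.

(** Half the total mass of the centred normal density with standard deviation [c^-1]. *)
Lemma integral_expR_sqr (R : realType) (c : R) : 0 < c ->
  (\int[@lebesgue_measure R]_(u in `[0%R, +oo[) (expR (- (c ^+ 2 * u ^+ 2 / 2)))%:E =
   (Num.sqrt (pi / 2) / c)%:E)%E.
Proof.
move=> c0.
have cV : c^-1 != 0 by rewrite invr_eq0 gt_eqF.
pose q := normal_peak c^-1.
have q0 : 0 < q by exact: normal_peak_gt0.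
pose f (u : R) := expR (- (c ^+ 2 * u ^+ 2 / 2)).
have pdfE u : normal_pdf 0 c^-1 u = q * f u.
  rewrite normal_pdfE// /normal_fun subr0 -/q /f; congr (_ * expR _).
  by field; rewrite gt_eqF.
have cf : continuous f by exact: continuous_gauss.
have mf : measurable_fun setT f by exact: continuous_measurable_fun.
have := @integral_normal_pdf R 0 c^-1.
under eq_integral do rewrite pdfE EFinM.
rewrite ge0_integralZl//; last 3 first.
- exact/measurable_EFinP.
- by move=> u _; rewrite lee_fin expR_ge0.
- by rewrite lee_fin ltW.
rewrite ge0_symfun_integralT//; last 2 first.
- by move=> u; exact: expR_ge0.
- by move=> u; rewrite /f /= sqrrN.
rewrite -set_itvcy => h.
have -> : (\int[@lebesgue_measure R]_(u in `[0%R, +oo[) (f u)%:E = (q^-1 / 2)%:E)%E.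
  rewrite -[RHS]mule1 -h !muleA -!EFinM.
  by rewrite (_ : q^-1 / 2 * q * 2 = 1) ?mul1e//; field; rewrite gt_eqF.
congr EFin; rewrite /q /normal_peak invrK.
have E (p : R) : c^-1 ^+ 2 * p *+ 2 = (2 / c) ^+ 2 * (p / 2) by field; rewrite gt_eqF.
rewrite E sqrtrM ?sqr_ge0// sqrtr_sqr ger0_norm ?divr_ge0 ?(ltW c0)//.
by move: (Num.sqrt _) => z; field; rewrite gt_eqF.
Qed.

(** By continuity and density of dyadic times. The inequalities in the limit are weak, which is why
    the interval is shrunk later on. *)
Lemma dyadic_inside_segment (d : measure_display) (T : measurableType d) (R : realType)
    (P : probability T R) (x : R) (B : R -> {RV P >-> R}) (a b t s : R) (w : T) :
  {within `[0, +oo[, continuous (fun u : R => B u w)} ->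
  dyadic_inside x B a b t w -> 0 <= s <= t -> a <= position x B s w <= b.
Proof.
move=> cBw dw /andP[s0 st].
have near_s (e : R) : 0 < e -> exists2 u, inside x B a b u w & `|position x B s w - position x B u w| <= e.
  move=> e0; have [n _ /(_ _ (leqnn n)) hn] := unif_continuous_segment t cBw e0.
  have p0 : 0 < 2 ^+ n :> R by rewrite exprn_gt0.
  (* Rounding [s] down keeps the dyadic time at most [t], where the hypothesis applies. *)
  have /truncn_itv /andP[k1 k2] : 0 <= s * 2 ^+ n by rewrite mulr_ge0// ltW.
  set k := Num.trunc _ in k1 k2.
  have us : k%:R / 2 ^+ n <= s by rewrite ler_pdivrMr.
  have u0 : 0 <= k%:R / 2 ^+ n :> R by rewrite divr_ge0// ltW.
  exists (k%:R / 2 ^+ n); first by apply: dw; exact: le_trans st.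
  rewrite /position (_ : x + _ - _ = B s w - B (k%:R / 2 ^+ n) w); last by ring.
  apply: hn => //; first by rewrite u0 (le_trans us).
  rewrite ger0_norm ?subr_ge0// lerBlDr -[X in X + _]div1r -mulrDl.
  by rewrite ler_pdivlMr// addrC natr1 ltW.
apply/andP; split; apply/ler_addgt0Pr => e /near_s[u /andP[au ub]]; rewrite ler_norml => /andP[h1 h2].
  by move: h1 h2 au ub; move: (position x B s w) (position x B u w) => X Y; lra.
by move: h1 h2 au ub; move: (position x B s w) (position x B u w) => X Y; lra.
Qed.

Lemma norm_Rintegral_probability_le (d : measure_display) (T : measurableType d) (R : realType)
    (P : probability T R) (f : T -> R) (M : R) :
  measurable_fun setT f -> (forall w, `|f w| <= M) -> `|\int[P]_w f w| <= M.
Proof.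
move=> mf fM; have fi := @finite_bounded_integrable R _ _ P f M mf fM.
apply: (le_trans (le_normr_Rintegral _ _)) => //.
rewrite -[leRHS](Rintegral_cst_probability P); apply: le_Rintegral => //.
  exact: integrable_norm.
exact: finite_measure_integrable_cst.
Qed.

(** * The survival series and the mean survival time *)

Section Survival.
Context d (T : measurableType d) (R : realType) (P : probability T R).
Variables (x : R) (B : R -> {RV P >-> R}).
Hypothesis hB : brownian_motion x B.
Variables (a b : R).
Hypothesis axb : a < x < b.
Notation odd_real := (@odd_real R).
Notation dyadic_inside := (dyadic_inside x B a b).
Notation inside := (inside x B a b).
Notation position := (position x B).

Lemma position_neq_ae (t c : R) : 0 < t -> {ae P, forall w, position t w <> c}.
Proof.
move=> t0; exists ((fun w => B t w - B 0 w) @^-1` [set c - x]); split.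
- rewrite -[X in measurable X]setTI; apply: (@measurable_funB _ _ _ setT (B t) (B 0)) => //.
- rewrite (bm_normal hB)// subr0 normal_prob_set1// sqrtr_gt0//.
- by move=> w /= /contrapT; rewrite /position => <- /=; ring.
Qed.

(** At time [t] a path in [dyadic_inside t] lies in [a, b], and the two endpoints have probability
    zero under the normal law. *)
Lemma prob_dyadic_inside (t : R) : 0 < t -> P (dyadic_inside t `&` inside t) = P (dyadic_inside t).
Proof.
move=> t0.
have mD := measurable_dyadic_inside x B a b t.
have mA : measurable (dyadic_inside t `&` inside t).
  by apply: measurableI => //; exact: measurable_inside.
rewrite -[in LHS](setIT (_ `&` _)) -[in RHS](setIT (dyadic_inside t)) -!integral_indic//.
apply: ae_eq_integral => //; [exact/measurable_EFinP/measurable_indic|exact/measurable_EFinP/measurable_indic|].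
have := position_neq_ae b t0; have := position_neq_ae a t0; have := bm_continuous hB.
apply: filterS3 => w cBw /eqP na /eqP nb _; congr EFin; rewrite !indicE in_setI.
have [/[!inE] dw|//] := boolP (w \in dyadic_inside t).
have tt : 0 <= t <= t by rewrite ltW/=.
have /andP[aX Xb] := dyadic_inside_segment cBw dw tt.
by rewrite mem_set//= /inside/= !lt_neqAle eq_sym na nb aX Xb.
Qed.

Let freq (k : nat) : R := odd_real k * (pi / (b - a)).

Definition survival_sum (n : nat) (t : R) : R :=
  \sum_(k < n) expR (- (freq k ^+ 2 * t / 2)) * sin (freq k * (x - a)) / odd_real k.

Let len_gt0 : 0 < b - a. Proof. by rewrite subr_gt0; have /andP[] := axb; exact: lt_trans. Qed.

Let sin_freq k : sin (freq k * (b - a)) = 0.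
Proof.
rewrite /freq -mulrA -mulrA mulVf ?gt_eqF// mulr1 /odd_real.
rewrite (_ : _ * pi = (2 * k + 1)%:R * pi); first exact: sin_natpi.
by rewrite natrD natrM.
Qed.

Let wave (t : R) (n : nat) (w : T) : R :=
  \1_(dyadic_inside t `&` inside t) w * square_wave n (pi / (b - a) * (position t w - a)).

Let mA t : measurable (dyadic_inside t `&` inside t).
Proof. by apply: measurableI; [exact: measurable_dyadic_inside|exact: measurable_inside]. Qed.

Let angle_inside t w : inside t w -> 0 < pi / (b - a) * (position t w - a) < pi.
Proof.
move=> /andP[aX Xb].
rewrite mulr_gt0 ?divr_gt0 ?pi_gt0 ?subr_gt0//=; last exact: lt_trans Xb.
by rewrite mulrAC ltr_pdivrMr// ltr_pM2l ?pi_gt0// ltrD2r.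
Qed.

Let norm_wave_le t n w : `|wave t n w| <= 4.
Proof.
rewrite /wave indicE; have [/[!inE] -[_ /angle_inside /andP[y0 ypi]]|_] := boolP (w \in _).
  by rewrite mul1r; apply: square_wave_bound; rewrite !ltW.
by rewrite mul0r normr0.
Qed.

Let measurable_wave_term t k : measurable_fun setT
  (fun w => \1_(dyadic_inside t `&` inside t) w * sin (freq k * (position t w - a))).
Proof.
apply: measurable_funM; first exact: measurable_indic.
apply: (measurableT_comp (@measurable_sin R)); apply: measurable_funM => //.
by apply: measurable_funB => //; exact: measurable_position.
Qed.

Let integrable_wave_term t k : P.-integrable setT (EFin \o
  (fun w => \1_(dyadic_inside t `&` inside t) w * sin (freq k * (position t w - a)) / odd_real k)).
Proof.
apply: (@finite_bounded_integrable R _ _ P _ ((odd_real k)^-1)) => [|w].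
  by apply: measurable_funM => //; exact: measurable_wave_term.
have o0 : 0 <= odd_real k by rewrite ltW// odd_real_gt0.
rewrite !normrM normfV [`|odd_real k|]ger0_norm// ler_piMl ?invr_ge0//.
by apply: mulr_ile1; rewrite ?normr_ge0 ?sin_max// indicE; case: (_ \in _); rewrite ?normr1 ?normr0.
Qed.

Let waveS t n w : wave t n.+1 w = wave t n w +
  \1_(dyadic_inside t `&` inside t) w * sin (freq n * (position t w - a)) / odd_real n.
Proof. by rewrite /wave /square_wave big_ord_recr/= mulrDr /freq -!mulrA. Qed.

Let integrable_wave t n : P.-integrable setT (EFin \o wave t n).
Proof.
elim: n => [|n ih].
  apply: (eq_integrable _ (cst 0%E)) => // [w _|]; last exact: integrable0.
  by rewrite /= /wave /square_wave big_ord0 mulr0.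
apply: (eq_integrable _ (fun w => (wave t n w)%:E +
  (\1_(dyadic_inside t `&` inside t) w * sin (freq n * (position t w - a)) / odd_real n)%:E)%E) => //.
  by move=> w _; rewrite /= waveS.
by apply: integrableD => //; exact: integrable_wave_term.
Qed.

Lemma integral_wave (t : R) n : 0 <= t -> \int[P]_w wave t n w = survival_sum n t.
Proof.
move=> t0; elim: n => [|n ih].
  rewrite /survival_sum big_ord0 -[RHS](Rintegral_cst_probability P).
  by apply: eq_Rintegral => w _; rewrite /wave /square_wave big_ord0 mulr0.
rewrite /survival_sum big_ord_recr/= -/(survival_sum n t) -ih.
under eq_Rintegral do rewrite waveS.
rewrite (RintegralD measurableT (integrable_wave t n) (integrable_wave_term t n)).
congr (_ + _); rewrite RintegralZr//.
  by congr (_ / _); apply: (integral_sin_inside hB t0 axb); exact: sin_freq.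
apply: (@finite_bounded_integrable R _ _ P _ 1) => [|w]; first exact: measurable_wave_term.
by rewrite normrM mulr_ile1 ?normr_ge0 ?sin_max// indicE; case: (_ \in _); rewrite ?normr1 ?normr0.
Qed.

Lemma norm_survival_sum_le (t : R) n : 0 <= t -> `|survival_sum n t| <= 4.
Proof.
move=> t0; rewrite -integral_wave//; apply: norm_Rintegral_probability_le => //.
by have /integrableP[/measurable_EFinP] := integrable_wave t n.
Qed.

(** On the surviving event the rescaled position lies in (0, pi), where the square waves tend to pi
    / 4; they are bounded by 4, so the expectations converge too. *)
Lemma survival_sum_cvg (t : R) : 0 < t ->
  survival_sum n t @[n --> \oo] --> pi / 4 * fine (P (dyadic_inside t)).
Proof.
move=> t0.
have [|||||_ _] := @dominated_convergence _ _ R P setT measurableT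
  (fun n w => (wave t n w)%:E) (fun w => (\1_(dyadic_inside t `&` inside t) w * (pi / 4))%:E) (cst 4%:E).
- by move=> n; have /integrableP[] := integrable_wave t n.
- by apply/measurable_EFinP; apply: measurable_funM => //; exact: measurable_indic.
- apply: aeW => w _; apply: cvg_EFin; first exact: nearW.
  rewrite /wave indicE; have [/[!inE] -[_ /angle_inside yi]|_] := boolP (w \in _).
    by under eq_fun do rewrite mul1r; rewrite mul1r; exact: square_wave_cvg.
  by under eq_fun do rewrite mul0r; rewrite mul0r; exact: cvg_cst.
- exact: finite_measure_integrable_cst.
- by apply: aeW => w n _; rewrite lee_fin norm_wave_le.
move=> cv; rewrite -prob_dyadic_inside//.
have -> : pi / 4 * fine (P (dyadic_inside t `&` inside t)) =
    fine (\int[P]_w (\1_(dyadic_inside t `&` inside t) w * (pi / 4))%:E).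
  rewrite -[RHS]/(Rintegral _ _ _) RintegralZr//; last first.
    apply: (@finite_bounded_integrable R _ _ P _ 1) => // w.
    by rewrite indicE; case: (_ \in _); rewrite ?normr1 ?normr0.
  by rewrite mulrC /Rintegral integral_indic// setIT.
have -> : survival_sum ^~ t = fun n => fine (\int[P]_w (wave t n w)%:E).
  by apply/funext => n; rewrite -integral_wave// ltW.
apply: fine_cvg; rewrite fineK//.
apply: integrable_fin_num => //.
apply: (@finite_bounded_integrable R _ _ P _ (pi / 4)) => [|w].
  by apply: measurable_funM => //; exact: measurable_indic.
have pi4 : 0 <= pi / 4 :> R by rewrite divr_ge0// pi_ge0.
rewrite normrM ger0_norm// ger0_norm ?(pi4)//.
by rewrite ler_piMl// indicE; case: (_ \in _).
Qed.

Definition survival_bound : R := 4 + 4 * ((b - a) / pi) ^+ 2.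

(** The sum itself is at most 4, and [t] times the sum is bounded through [t exp (- c t) <= 1 / c]
    and [sum_k 1 / (2 k + 1) ^ 2 <= 2]. With t = u ^ 2 this is an integrable majorant independent of
    [n]. *)
Lemma norm_survival_sum_le_inv (t : R) n : 0 <= t ->
  `|survival_sum n t| <= survival_bound / (1 + t).
Proof.
move=> t0; have pi0 := @pi_gt0 R.
have t1 : 0 < 1 + t by rewrite ltr_wpDr.
rewrite ler_pdivlMr// mulrDr mulr1 lerD ?norm_survival_sum_le//.
rewrite -{2}(ger0_norm t0) -normrM /survival_sum mulr_suml.
apply: (le_trans (ler_norm_sum _ _ _)).
have -> : 4 * ((b - a) / pi) ^+ 2 = 2 * ((b - a) / pi) ^+ 2 * 2 by ring.
apply: (@le_trans _ _ (2 * ((b - a) / pi) ^+ 2 * \sum_(k < n) (odd_real k ^+ 2)^-1)); last first.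
  by rewrite ler_pM2l ?sum_odd_sqrV_le// mulr_gt0// exprn_gt0// divr_gt0.
rewrite mulr_sumr; apply: ler_sum => k _.
have o0 := @odd_real_gt0 R k.
have f0 : 0 < freq k by rewrite mulr_gt0// divr_gt0.
have -> : expR (- (freq k ^+ 2 * t / 2)) * sin (freq k * (x - a)) / odd_real k * t =
   sin (freq k * (x - a)) / odd_real k * (t * expR (- (freq k ^+ 2 / 2 * t))).
  rewrite (_ : freq k ^+ 2 * t / 2 = freq k ^+ 2 / 2 * t); last by ring.
  ring.
rewrite normrM -[leRHS]mul1r ler_pM//.
  rewrite normrM normfV [`|odd_real k|]gtr0_norm//.
  apply: mulr_ile1; rewrite ?normr_ge0 ?sin_max ?invr_ge0 ?(ltW o0)//.
  by rewrite invf_le1// lerDr mulr_ge0.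
rewrite ger0_norm ?mulr_ge0 ?expR_ge0//; apply: (le_trans (mul_expRN_le _ t0)).
  by rewrite divr_gt0// exprn_gt0.
rewrite le_eqVlt; apply/orP; left; apply/eqP; rewrite /freq.
have E (o q L : R) : o != 0 -> q != 0 -> L != 0 ->
  ((o * (q / L)) ^+ 2 / 2)^-1 = 2 * (L / q) ^+ 2 / o ^+ 2.
  by move=> ? ? ?; field; apply/and3P.
by rewrite E ?gt_eqF.
Qed.

Notation mu := (@lebesgue_measure R).

Let gauss_term k : mu.-integrable `[0, +oo[ (fun u => (expR (- (freq k ^+ 2 * u ^+ 2 / 2)))%:E).
Proof.
have f0 : 0 < freq k by rewrite mulr_gt0 ?odd_real_gt0// divr_gt0// pi_gt0.
have mg := continuous_measurable_fun (@continuous_gauss R (freq k)).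
apply/integrableP; split; first by apply/measurable_EFinP; exact: measurable_funTS.
under eq_integral do rewrite gee0_abs ?lee_fin ?expR_ge0//.
by rewrite integral_expR_sqr// ltry.
Qed.

Let waveV k : R := sin (freq k * (x - a)) / odd_real k.

Let survival_sumS n u : (survival_sum n.+1 (u ^+ 2))%:E =
  ((survival_sum n (u ^+ 2))%:E + (expR (- (freq n ^+ 2 * u ^+ 2 / 2)))%:E * (waveV n)%:E)%E.
Proof. 
rewrite /survival_sum big_ord_recr/= -EFinM -EFinD; congr (_ + _)%:E.
exact/esym/mulrA.
Qed.

Let integrable_survival_sum n : mu.-integrable `[0, +oo[ (fun u => (survival_sum n (u ^+ 2))%:E).
Proof.
elim: n => [|n ih].
  apply: (eq_integrable _ (cst 0%E)) => // [u _|]; last exact: integrable0.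
  by rewrite /survival_sum big_ord0.
rewrite (_ : (fun u => (survival_sum n.+1 (u ^+ 2))%:E) = ((fun u => (survival_sum n (u ^+ 2))%:E) \+
    ((fun u => (expR (- (freq n ^+ 2 * u ^+ 2 / 2)))%:E) \* cst (waveV n)%:E))%E).
  by apply: integrableD => //; apply: integrableZr.
by apply/funext => u; exact: survival_sumS.
Qed.

Let angle : R := pi / (b - a) * (x - a).

Lemma integral_survival_sum n :
  (\int[mu]_(u in `[0%R, +oo[) (survival_sum n (u ^+ 2))%:E =
  ((b - a) / pi * Num.sqrt (pi / 2) * clausen_sum n angle)%:E)%E.
Proof.
elim: n => [|n ih].
  rewrite integral0_eq; first by rewrite /clausen_sum big_ord0 mulr0.
  by move=> u _; rewrite /survival_sum big_ord0.
under eq_integral do rewrite survival_sumS.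
have iZ : mu.-integrable `[0, +oo[
    ((fun u => (expR (- (freq n ^+ 2 * u ^+ 2 / 2)))%:E) \* cst (waveV n)%:E)%E.
  by apply: integrableZr.
rewrite integralD// [X in (X + _)%E]ih integralZr//.
have f0 : 0 < freq n by rewrite mulr_gt0 ?odd_real_gt0// divr_gt0// pi_gt0.
rewrite integral_expR_sqr// /clausen_sum big_ord_recr/= -EFinM -EFinD; congr EFin.
rewrite mulrDr; congr (_ + _).
rewrite /waveV /freq /angle -[odd_real n * _ * _]mulrA.
have E (r s o q L : R) : o != 0 -> q != 0 -> L != 0 ->
    r / (o * (q / L)) * (s / o) = L / q * r * (s / o ^+ 2).
  by move=> o0 q0 L0; field; apply/and3P.
by rewrite E ?odd_real_neq0 ?gt_eqF ?pi_gt0.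
Qed.

(** The second coordinate is the square root of time, so the length of the section over a path is
    its survival time after taking the square root. *)
Definition survival_region : set (T * R) :=
  [set z | 0 <= z.2 /\ dyadic_inside (z.2 ^+ 2) z.1].

Lemma measurable_survival_region : measurable survival_region.
Proof.
(* The condition imposed at a dyadic time q is vacuous when u ^ 2 < q, so it is a union of two
   rectangles. *)
rewrite (_ : survival_region = (setT `*` `[0, +oo[) `&` \bigcap_n \bigcap_j
    ((inside (j%:R / 2 ^+ n) `*` setT) `|`
     (setT `*` ((fun u => u ^+ 2) @^-1` `]-oo, j%:R / 2 ^+ n[)))); last first.
  apply/seteqP; split => -[w u] /=.
    move=> [u0 dw]; split; first by rewrite in_itv/= u0.
    move=> n _ j _; have [ju|uj] := leP (j%:R / 2 ^+ n) (u ^+ 2).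
      by left; split => //; exact: dw.
    by right; split => //=; rewrite in_itv.
  rewrite in_itv/= andbT => -[[_ u0] h]; split => // n j jt.
  have [[]//|[_]] := h n I j I.
  by rewrite /= in_itv/= ltNge jt.
apply: measurableI; first by apply: measurableX.
apply: bigcapT_measurable => n; apply: bigcapT_measurable => j.
apply: measurableU; apply: measurableX => //; first exact: measurable_inside.
by rewrite -[X in measurable X]setTI; exact: exprn_measurable.
Qed.

Lemma ysection_survival_region u :
  ysection survival_region u = if 0 <= u then dyadic_inside (u ^+ 2) else set0.
Proof.
apply/seteqP; split => w; rewrite /ysection/= inE.
  by move=> [/= -> ].
by case: ifP.
Qed.

(** The series is integrated termwise, each Gaussian contributing [1 / (2 k + 1)] and thus turning
    the square wave into Phi. The constant is [4 / pi * (1 / pi) * sqrt (pi / 2)]. *)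
Lemma integral_prob_survival :
  (\int[mu]_(u in `[0%R, +oo[) P (ysection survival_region u) =
   ((b - a) * (Num.sqrt (2 / pi) * (2 / pi)) * clausen angle)%:E)%E.
Proof.
have pi0 := @pi_gt0 R.
have mR := measurable_survival_region.
have mP : measurable_fun setT (P \o ysection survival_region) by exact: measurable_fun_ysection.
have Pfin u : P (ysection survival_region u) \is a fin_num.
  by apply: fin_num_measure; exact: measurable_ysection.
have [|||||_ _ cv] := @dominated_convergence _ _ R mu `[0, +oo[%classic (measurable_itv _)
  (fun n u => (survival_sum n (u ^+ 2))%:E)
  (fun u => ((pi / 4)%:E * P (ysection survival_region u))%E)
  (fun u => (survival_bound / oneDsqr u)%:E).
- by move=> n; have /integrableP[] := integrable_survival_sum n.
- by apply: measurable_funTS; exact: measurable_funeM.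
(* At u = 0 the series need not be controlled: convergence was proved for positive times only, and
   one point is negligible. *)
- exists [set 0]; split; [exact: measurable_set1|exact: lebesgue_measure_set1|].
  move=> u /=; apply: contra_notP => u0 u1.
  have {}u0 : 0 < u by rewrite lt_neqAle eq_sym; apply/andP; split; [exact/eqP|move: u1; rewrite in_itv/= andbT].
  rewrite ysection_survival_region (ltW u0) -[P _]fineK ?fin_num_measure//; last exact: measurable_dyadic_inside.
  rewrite -EFinM; apply: cvg_EFin; first exact: nearW.
  by apply: survival_sum_cvg; rewrite exprn_gt0.
- rewrite (_ : (fun u => (survival_bound / oneDsqr u)%:E) =
      (cst survival_bound%:E \* (fun u => ((oneDsqr u)^-1)%:E))%E); last by [].
  apply: integrableZl => //; apply/integrableP; split.
    apply/measurable_EFinP; apply: measurable_funTS.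
    exact: continuous_measurable_fun (@continuous_oneDsqrV R).
  under eq_integral do rewrite gee0_abs ?lee_fin ?invr_ge0 ?(le_trans ler01 (oneDsqr_ge1 _))//.
  by rewrite integral0y_oneDsqr ltry.
- apply: aeW => u n u0; rewrite abse_EFin lee_fin /oneDsqr.
  by apply: norm_survival_sum_le_inv; exact: sqr_ge0.
have pi4 : 0 < pi / 4 :> R by rewrite divr_gt0.
have : (\int[mu]_(u in `[0%R, +oo[) ((pi / 4)%:E * P (ysection survival_region u)))%E =
    ((b - a) / pi * Num.sqrt (pi / 2) * clausen angle)%:E.
  rewrite -(cvg_lim _ cv)//; apply/cvg_lim => //.
  under eq_fun do rewrite integral_survival_sum.
  apply: cvg_EFin; first exact: nearW.
  by apply: cvgMr; exact: clausen_sum_cvg.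
rewrite ge0_integralZl//; last 2 first.
- exact: measurable_funTS.
- by rewrite lee_fin ltW.
move=> h.
have {h} : (((pi / 4)^-1)%:E * ((pi / 4)%:E * \int[mu]_(u in `[0%R, +oo[) P (ysection survival_region u)) =
   ((pi / 4)^-1)%:E * ((b - a) / pi * Num.sqrt (pi / 2) * clausen angle)%:E)%E by rewrite h.
rewrite muleA -!EFinM mulVf ?gt_eqF// mul1e => ->; congr EFin.
have -> : Num.sqrt (pi / 2) = pi / 2 * Num.sqrt (2 / pi) :> R.
  have E (q : R) : 0 < q -> q / 2 = (q / 2) ^+ 2 * (2 / q) by move=> q0; field; rewrite gt_eqF.
  by rewrite {1}(E pi)// sqrtrM ?sqr_ge0// sqrtr_sqr ger0_norm// divr_ge0// ltW.
have E (q L r c : R) : 0 < q -> (q / 4)^-1 * (L / q * (q / 2 * r) * c) = L * (r * (2 / q)) * c.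
  by move=> q0; field; rewrite gt_eqF.
exact: E.
Qed.

(** Tonelli on [survival_region]: the mean length of the sections over paths is the integral of the
    survival probabilities. *)
Lemma integral_survival_time :
  (\int[P]_w mu (xsection survival_region w) =
   ((b - a) * (Num.sqrt (2 / pi) * (2 / pi)) * clausen angle)%:E)%E.
Proof.
have mR := measurable_survival_region.
have := indic_fubini_tonelli P mu mR.
rewrite indic_fubini_tonelli_FE// indic_fubini_tonelli_GE// => ->.
rewrite -integral_prob_survival [RHS]integral_mkcond.
apply: eq_integral => u _; rewrite /= patchE mem_setE in_itv/= andbT.
case: ifPn => // u0; rewrite ysection_survival_region (negbTE u0) measure0//.
Qed.

End Survival.

(** * From survival times to the exit time *)

Section NonmeasurableIntegral.
Context d (T : measurableType d) (R : realType) (m : {measure set T -> \bar R}).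
Local Open Scope ereal_scope.

Lemma ge0_le_integral_nonmeasurable (f g : T -> \bar R) : (forall w, 0 <= f w) ->
  (forall w, f w <= g w) -> \int[m]_w f w <= \int[m]_w g w.
Proof.
move=> f0 fg; have g0 w : 0 <= g w by exact: le_trans (f0 w) (fg w).
rewrite !ge0_integralTE//; apply: le_ereal_sup => _ [h hf <-]; exists h => //= w.
exact: le_trans (hf w) (fg w).
Qed.

(** Only the survival time is known to be measurable. The exceptional null set is handled on that
    side alone, by setting the smaller function to 0 there; in the companion lemma the larger one is
    set to +oo. *)
Lemma ae_ge0_le_integral_measurable_left (f g : T -> \bar R) : (forall w, 0 <= f w) ->
  (forall w, 0 <= g w) -> measurable_fun setT f -> {ae m, forall w, f w <= g w} ->
  \int[m]_w f w <= \int[m]_w g w.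
Proof.
move=> f0 g0 mf [N [mN N0 fgN]].
have -> : \int[m]_w f w = \int[m]_w (f \_ (~` N)) w.
  apply: ae_eq_integral => //.
    by apply/(measurable_restrictT _ _).1; [exact: measurableC|exact: measurable_funTS].
  exists N; split => // w; apply: contra_notP => Nw _.
  by rewrite patchE mem_set.
apply: ge0_le_integral_nonmeasurable => w; rewrite patchE; case: ifPn => //.
by rewrite inE => Nw; apply: contrapT => h; apply: Nw; exact: fgN.
Qed.

Lemma ae_ge0_le_integral_measurable_right (f g : T -> \bar R) : (forall w, 0 <= f w) ->
  (forall w, 0 <= g w) -> measurable_fun setT g -> {ae m, forall w, f w <= g w} ->
  \int[m]_w f w <= \int[m]_w g w.
Proof.
move=> f0 g0 mg [N [mN N0 fgN]].
pose h w := if w \in N then +oo else g w.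
have mh : measurable_fun setT h.
  apply: measurable_fun_ifT => //.
  by apply: (measurable_fun_bool true); rewrite setTI preimage_mem_true.
have -> : \int[m]_w g w = \int[m]_w h w.
  apply: ae_eq_integral => //.
  exists N; split => // w; apply: contra_notP => Nw _.
  by rewrite /h memNset.
apply: ge0_le_integral_nonmeasurable => // w; rewrite /h; case: ifPn => [_|]; first exact: leey.
rewrite notin_setE => Nw; apply: contrapT => h1; apply: Nw; exact: fgN.
Qed.
End NonmeasurableIntegral.

Section ExitTime.
Context {T : Type} {R : realType}.
Variable (B : R -> T -> R).
Local Open Scope ereal_scope.

Lemma exit_time_ge0 w : 0 <= exit_time B w.
Proof. by apply: le_ereal_inf_tmp => _ [t [t0 _] <-]; rewrite lee_fin. Qed.

Lemma lt_exit_time s w : (0 <= s)%R -> s%:E < exit_time B w -> (0 < B s w < 1)%R.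
Proof.
move=> s0; rewrite ltNge => /negP h; apply: contrapT => nB; apply: h.
by apply: ereal_inf_lbound; exists s => //; split => //; apply/negP; rewrite in_itv/=.
Qed.

Lemma exit_time_ge t w : (forall s, 0 <= s <= t -> 0 < B s w < 1)%R -> t%:E <= exit_time B w.
Proof.
move=> h; apply: le_ereal_inf_tmp => _ [s [s0 nB] <-]; rewrite lee_fin leNgt.
by apply: contra nB => st; rewrite in_itv/= h// s0 ltW.
Qed.
End ExitTime.

Section SurvivalTime.
Context d (T : measurableType d) (R : realType) (P : probability T R).
Variables (p : R) (B : R -> {RV P >-> R}).
Hypothesis hB : brownian_motion p B.
Notation mu := (@lebesgue_measure R).
Notation time a b w := (mu (xsection (survival_region p B a b) w)).
Notation tau := (exit_time (fun t : R => B t : T -> R)).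

Let measurable_survival_section a b w :
  measurable (xsection (survival_region p B a b) w).
Proof. by apply: measurable_xsection; exact: measurable_survival_region. Qed.

Lemma sqrte_exit_time_le w : B 0 w = p -> (sqrte (tau w) <= time 0 1 w)%E.
Proof.
move=> B0.
have sub (u : R) : 0 <= u -> ((u ^+ 2)%:E < tau w)%E -> xsection (survival_region p B 0 1) w u.
  move=> u0 ut; rewrite /xsection/= inE; split => //= n j jt.
  rewrite /inside/= /position B0 addrC subrK.
  apply: (@lt_exit_time _ _ (fun t : R => B t : T -> R)).
    by rewrite divr_ge0.
  by apply: le_lt_trans ut; rewrite lee_fin.
have mX := measurable_survival_section 0 1 w.
have := exit_time_ge0 (fun t : R => B t : T -> R) w; move: sub.
case: (tau w) => [t||] sub t0 //=.
  rewrite lee_fin in t0; have := sqrtr_ge0 t; rewrite le_eqVlt => /predU1P[<-|st] //.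
  have -> : (Num.sqrt t)%:E = mu `[0%R, Num.sqrt t[ :> \bar R.
    by rewrite lebesgue_measure_itv/= lte_fin st sube0.
  apply: le_measure; rewrite ?inE//.
  move=> u /=; rewrite in_itv/= => /andP[u0 ut]; apply: sub => //.
  by rewrite lte_fin -[t]sqr_sqrtr// ltrXn2r.
have -> : +oo%E = mu `[0%R, +oo[ :> \bar R by rewrite lebesgue_measure_itv/= ltry.
apply: le_measure; rewrite ?inE//.
by move=> u /=; rewrite in_itv/= andbT => u0; apply: sub => //; rewrite ltry.
Qed.

Lemma sqrte_exit_time_ge (a b : R) w : 0 < a -> b < 1 -> B 0 w = p ->
  {within `[0, +oo[, continuous (fun u : R => B u w)} -> (time a b w <= sqrte (tau w))%E.
Proof.
move=> a0 b1 B0 cBw.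
have sub (u : R) : xsection (survival_region p B a b) w u -> 0 <= u /\ ((u ^+ 2)%:E <= tau w)%E.
  rewrite /xsection/= inE => -[/= u0 dw]; split => //; apply: exit_time_ge => s su.
  have := dyadic_inside_segment cBw dw su.
  rewrite /position B0 addrC subrK => /andP[aB Bb].
  by rewrite (lt_le_trans a0 aB) (le_lt_trans Bb b1).
have mX := measurable_survival_section a b w.
have := exit_time_ge0 (fun t : R => B t : T -> R) w; move: sub.
case: (tau w) => [t||] sub t0 //=; last by rewrite leey.
rewrite lee_fin in t0.
apply: (@le_trans _ _ (mu `[0%R, Num.sqrt t])); last first.
  by rewrite lebesgue_measure_itv/= lte_fin; case: ifP => _; rewrite ?sube0// lee_fin.
apply: le_measure; rewrite ?inE//.
move=> u /sub[u0]; rewrite lee_fin /= in_itv/= u0 => /ler_wsqrtr.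
by rewrite sqrtr_sqr ger0_norm.
Qed.

Let measurable_time (a b : R) : measurable_fun setT (fun w => time a b w).
Proof.
have mR := measurable_survival_region p B a b.
exact: (measurable_fun_xsection mu mR).
Qed.

Lemma expected_sqrt_exit_time_eq : 0 <= p <= 1 -> expected_sqrt_exit_time B =
  (Num.sqrt (2 / pi) * (2 / pi) * clausen (pi * p))%:E.
Proof.
move=> /andP[p0 p1]; pose K : R := Num.sqrt (2 / pi) * (2 / pi) * clausen (pi * p).
have s0 w : (0 <= sqrte (tau w))%E by exact: sqrte_ge0.
have E0 : (0 <= expected_sqrt_exit_time B)%E by apply: integral_ge0 => w _.
(* The killed walk must start strictly inside. At p = 0 and p = 1 the exit is immediate, and the
   right-hand side vanishes as well. *)
have [pb|] := boolP (0 < p < 1); last first.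
  move=> np; have pE : p = 0 \/ p = 1.
    by move: np; rewrite !lt_neqAle p0 p1 !andbT negb_and !negbK eq_sym => /orP[/eqP|/eqP]; [left|right].
  have -> : clausen (pi * p) = 0.
    by case: pE => ->; rewrite ?mulr0 ?clausen0// mulr1 -[pi]subr0 clausen_piB clausen0.
  rewrite mulr0; apply/eqP; rewrite eq_le E0 andbT -[leRHS](integral0 P setT).
  apply: ae_ge0_le_integral_measurable_right => //.
  apply: filterS (bm_start hB) => w B0.
  suff : (tau w <= 0)%E.
    by rewrite le_eqVlt => /predU1P[->|]; [rewrite sqrte0|rewrite ltNge exit_time_ge0].
  rewrite leNgt; apply/negP => t0.
  have := @lt_exit_time _ _ (fun t : R => B t : T -> R) 0 w (lexx _) t0; rewrite B0.
  by case: pE => ->; rewrite ltxx ?andbF.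
apply/eqP; rewrite eq_le; apply/andP; split.
  rewrite -/K; have := integral_survival_time hB pb.
  rewrite !subr0 divr1 mul1r -/K => <-.
  apply: ae_ge0_le_integral_measurable_right => //.
  by apply: filterS (bm_start hB) => w B0; exact: sqrte_exit_time_le.
(* The interval (e p, 1 - e (1 - p)) has closure in (0, 1), and p divides it in
   the same ratio as (0, 1). *)
have lower (e : R) : 0 < e < 1 -> (((1 - e) * K)%:E <= expected_sqrt_exit_time B)%E.
  move=> /andP[e0 e1]; have /andP[p0' p1'] := pb.
  pose a := e * p; pose b := 1 - e * (1 - p).
  have a0 : 0 < a by rewrite mulr_gt0.
  have b1 : b < 1 by rewrite gtrBl mulr_gt0// subr_gt0.
  have apb : a < p < b by rewrite /a /b; apply/andP; split; nra.
  have := integral_survival_time hB apb.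
  have -> : b - a = 1 - e by rewrite /a /b; ring.
  have -> : pi / (1 - e) * (p - a) = pi * p.
    have E (q : R) : q / (1 - e) * (p - e * p) = q * p by field; rewrite subr_eq0 gt_eqF.
    exact: E.
  rewrite -mulrA -/K => <-.
  apply: ae_ge0_le_integral_measurable_left => //.
  have := bm_continuous hB; have := bm_start hB; apply: filterS2 => w B0 cBw.
  exact: sqrte_exit_time_ge.
rewrite -/K; move: lower E0; case: (expected_sqrt_exit_time B) => [r||] lower r0; [|by rewrite leey|by []].
rewrite lee_fin in r0; rewrite lee_fin leNgt; apply/negP => rK.
have K0 : 0 < K by exact: le_lt_trans rK.
clear -r0 rK K0 lower; clearbody K.
(* For this [e], the lower bound [(1 - e) * K] is the midpoint of [r] and [K], hence above [r]. *)
have e01 : 0 < (K - r) / (2 * K) < 1.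
  apply/andP; split; first by rewrite divr_gt0 ?subr_gt0 ?mulr_gt0.
  by rewrite ltr_pdivrMr ?mulr_gt0//; lra.
have := lower _ e01; rewrite lee_fin.
rewrite (_ : (1 - (K - r) / (2 * K)) * K = (K + r) / 2); last by field; rewrite gt_eqF.
by lra.
Qed.
End SurvivalTime.

(** * The two constants and their sharpness *)

Section Constants.
Context {R : realType}.

Lemma half_xlog_pi (x : R) : 0 < x -> half_xlog (pi * x) = pi / 2 * xlog_inv x.
Proof.
move=> x0; rewrite /half_xlog /xlog_inv lnM ?posrE ?pi_gt0// lnV ?posrE//.
have E (q l m : R) : q * x / 2 * (l - (l + m)) = q / 2 * (x * - m) by field.
exact: E.
Qed.

Lemma lower_constE : Num.sqrt (2 / pi) * (2 / pi) * (pi / 2) = lower_const R.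
Proof.
have E (r q : R) : q != 0 -> r * (2 / q) * (q / 2) = r by move=> q0; field.
by rewrite E// gt_eqF// pi_gt0.
Qed.

Lemma upper_constE :
  Num.sqrt (2 / pi) * (2 / pi) * (catalan R / (pi / 4 * ln 2)) * (pi / 2) = upper_const R.
Proof.
have pi0 := @pi_gt0 R; have l2 : 0 < ln 2 :> R by rewrite ln_gt0// ltr1n.
rewrite /upper_const.
have -> : pi `^ (3 / 2) = pi * Num.sqrt pi :> R.
  rewrite (_ : 3 / 2 = 1 + 2^-1 :> R); last by field.
  by rewrite powRD ?powRr1 ?powR12_sqrt ?(ltW pi0)//; apply/implyP => _; rewrite gt_eqF.
rewrite sqrtrM// sqrtrV ?(ltW pi0)//.
have s0 : 0 < Num.sqrt pi :> R by rewrite sqrtr_gt0.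
have E (r q s G l : R) : q != 0 -> s != 0 -> l != 0 ->
  r / s * (2 / q) * (G / (q / 4 * l)) * (q / 2) = 4 * r * G / (q * s * l).
  by move=> q0 s1 l0; field; apply/and3P.
by rewrite E ?gt_eqF.
Qed.

Lemma lower_const_gt0 : 0 < lower_const R.
Proof. by rewrite sqrtr_gt0 divr_gt0// pi_gt0. Qed.

End Constants.

Theorem proposition1p2 (R : realType)
  (d : R -> measure_display)
  (T : forall p : R, measurableType (d p))
  (P : forall p : R, probability (T p) R)
  (B : forall p : R, R -> {RV (P p) >-> R})
  (hB : forall p : R, 0 <= p <= 1 -> brownian_motion p (B p)) :
  let E := fun p : R => expected_sqrt_exit_time (B p) in
  let phi := fun p : R => xlog_inv (Num.min p (1 - p)) in
  [/\ (forall p : R, 0 <= p <= 1 -> ((lower_const R * phi p)%:E <= E p)%E),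
      (forall p : R, 0 <= p <= 1 -> (E p <= (upper_const R * phi p)%:E)%E),
      (forall c : R, lower_const R < c ->
         ~ (forall p : R, 0 <= p <= 1 -> ((c * phi p)%:E <= E p)%E)) &
      (forall c : R, c < upper_const R ->
         ~ (forall p : R, 0 <= p <= 1 -> (E p <= (c * phi p)%:E)%E))].
Proof.
move=> E phi; pose k : R := Num.sqrt (2 / pi) * (2 / pi).
have pi0 := @pi_gt0 R.
have k0 : 0 <= k by rewrite mulr_ge0// divr_ge0// ltW.
have EE (p : R) : 0 <= p <= 1 -> E p = (k * clausen (pi * p))%:E.
  by move=> p01; exact: expected_sqrt_exit_time_eq (hB _ p01) p01.
have Emin (p : R) : 0 <= p <= 1 -> E p = (k * clausen (pi * Num.min p (1 - p)))%:E.
  move=> p01; rewrite EE//; congr (_ * _)%:E; rewrite minEle; case: ifP => // _.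
  by rewrite mulrBr mulr1 clausen_piB.
have min01 (p : R) : 0 <= p <= 1 -> 0 <= Num.min p (1 - p) <= 2^-1.
  by move=> /andP[p0 p1]; case: (leP p (1 - p)) => h; apply/andP; split; lra.
have half (x : R) : 0 < x <= 2^-1 -> 0 < pi * x <= pi / 2.
  by move=> /andP[x0 x2]; rewrite mulr_gt0//= ler_pM2l.
have k_half (x : R) : 0 < x -> k * half_xlog (pi * x) = lower_const R * xlog_inv x.
  by move=> x0; rewrite half_xlog_pi// mulrA -lower_constE.
have xlog0 : xlog_inv 0 = 0 :> R by rewrite /xlog_inv mul0r.
split=> [p p01|p p01|c cl h|c cu h].
- rewrite Emin// lee_fin /phi; have /andP[] := min01 p p01.
  move: (Num.min _ _) => x; rewrite le_eqVlt => /predU1P[<- _|x0 x2].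
    by rewrite xlog0 !mulr0 clausen0 mulr0.
  rewrite -k_half// ler_wpM2l// half_xlog_le_clausen// half// x0//.
- rewrite Emin// lee_fin /phi; have /andP[] := min01 p p01.
  move: (Num.min _ _) => x; rewrite le_eqVlt => /predU1P[<- _|x0 x2].
    by rewrite xlog0 !mulr0 clausen0 mulr0.
  rewrite -upper_constE -/k -[leRHS]mulrA -half_xlog_pi// -[leRHS]mulrA.
  by rewrite ler_wpM2l// clausen_le_half_xlog// half// x0.
- have l0 := @lower_const_gt0 R.
  (* With [p = expR (- M)] the logarithm of 1 / p is [M], and the upper estimate of Phi would force
     [(c - l) M <= l] for l the lower constant; this [M] makes the left side equal to [c]. Moreover
     [M >= 1 >= ln 2] puts [p] below 1 / 2. *)
  pose M := lower_const R / (c - lower_const R) + 1.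
  have M1 : 1 <= M by rewrite lerDr divr_ge0// ?subr_ge0 ltW.
  pose p : R := expR (- M).
  have p0 : 0 < p by exact: expR_gt0.
  have p2 : p <= 2^-1.
    rewrite /p expRN lef_pV2 ?posrE ?expR_gt0// -[leLHS](@lnK R) ?posrE// ler_expR.
    by have := @ln2_le R; lra.
  have p01 : 0 <= p <= 1 by rewrite ltW//=; lra.
  have := h _ p01; rewrite EE// lee_fin /phi min_l; last by lra.
  have := clausen_le_half_xlogD (half p _); rewrite p0 => /(_ p2).
  move=> /(ler_wpM2l k0); rewrite mulrDr k_half// => le1 le2.
  have kp : k * (pi * p / 2) = lower_const R * p.
    rewrite -lower_constE -/k.
    have F (q : R) : k * (q * p / 2) = k * (q / 2) * p by ring.
    exact: F.
  have := le_trans le2 le1; rewrite kp /xlog_inv {2 4}/p expRN invrK expRK.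
  have F (l c' q : R) : 0 < q -> l < c' ->
      c' * (q * (l / (c' - l) + 1)) <= l * (q * (l / (c' - l) + 1)) + l * q -> False.
    move=> q0 lc; set m := _ + 1 => hm.
    have me : (c' - l) * m = c' by rewrite /m; field; rewrite subr_eq0 gt_eqF.
    have : q * ((c' - l) * m - l) <= 0 by lra.
    by rewrite me; apply/negP; rewrite -ltNge mulr_gt0// subr_gt0.
  exact: F.
(* At p = 1 / 2 the upper inequality is an equality, because Phi (pi / 2) is Catalan's constant. *)
- have p01 : 0 <= (2^-1 : R) <= 1 by apply/andP; split; lra.
  have := h _ p01; rewrite EE// lee_fin /phi min_l; last by lra.
  have l2 : 0 < ln 2 :> R by rewrite ln_gt0// ltr1n.
  rewrite clausen_pihalf /xlog_inv invrK.
  have -> : k * catalan R = upper_const R * (2^-1 * ln 2).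
    rewrite -upper_constE -/k.
    have F (G q l : R) : q != 0 -> l != 0 -> k * G = k * (G / (q / 4 * l)) * (q / 2) * (2^-1 * l).
      by move=> q0 l0; field; apply/andP.
    by apply: F; rewrite gt_eqF.
  by rewrite ler_pM2r ?mulr_gt0// leNgt cu.
Qed.
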